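(* Let $0<\alpha<1$. Then there exists $c>0$ such that for every $f\in\Lambda_\alpha(\mathbb R)$, for arbitrary bounded self-adjoint operators $A$ and $B$ and a bounded operator $R$ on Hilbert space the following inequality holds: $$\|f(A)R-Rf(B)\|\le c\,\|f\|_{\Lambda_\alpha(\mathbb R)}\,\|AR-RB\|^\alpha\,\|R\|^{1-\alpha}.$$
   Context: For $0<\alpha<1$, $\Lambda_\alpha(\mathbb R)$ is the Hölder class of functions $f$ on $\mathbb R$ with $\|f\|_{\Lambda_\alpha(\mathbb R)}=\sup_{x\ne y}|f(x)-f(y)|/|x-y|^\alpha<\infty$. *)

(* Defs.v *)
From HB Require Import structures.
From mathcomp Require Import all_boot all_order all_algebra complex.
From mathcomp Require Import all_classical all_reals all_analysis.

Set Implicit Arguments.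
Unset Strict Implicit.
Unset Printing Implicit Defensive.

Import Order.TTheory GRing.Theory Num.Theory numFieldNormedType.Exports.

Local Open Scope classical_set_scope.
Local Open Scope ring_scope.
Local Open Scope complex_scope.

Definition holder_quotients (R : realType) (alpha : R) (f : R -> R[i]) : set R :=
  [set q | exists x y : R,
      x != y /\ q = complex.Re `|f x - f y| / `|x - y| `^ alpha].

Definition holder (R : realType) (alpha : R) (f : R -> R[i]) : Prop :=
  has_ubound (holder_quotients alpha f).

Definition holder_norm (R : realType) (alpha : R) (f : R -> R[i]) : R :=
  sup (holder_quotients alpha f).

(* A complex Hilbert space is a complete normed space over R[i] whose norm comes
   from an inner product, linear in its first argument. *)
Definition hilbert_norm (R : realType) (H : completeNormedModType R[i])
    (dot : {dot H for @Num.conj R[i]}) : Prop :=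
  forall x : H, `|x| ^+ 2 = dot x x.

Definition bounded_op (R : realType) (H : completeNormedModType R[i])
    (T : H -> H) : Prop :=
  [bounded T x | x in [set x : H | `|x| <= 1]].

(* In H the norm takes its values in R[i]; the operator norm is in R.  It is
   meaningful for bounded operators only, sup being 0 on unbounded sets. *)
Definition opnorm (R : realType) (H : completeNormedModType R[i])
    (T : H -> H) : R :=
  sup [set complex.Re `|T x| | x in [set x : H | `|x| <= 1]].

Definition selfadjoint (R : realType) (H : completeNormedModType R[i])
    (dot : {dot H for @Num.conj R[i]}) (A : {linear H -> H}) : Prop :=
  forall x y : H, dot (A x) y = dot x (A y).

Definition spectrum (R : realType) (H : completeNormedModType R[i])
    (A : {linear H -> H}) : set R[i] :=
  [set z | ~ exists S : {linear H -> H},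
      [/\ bounded_op S,
          forall x, S (A x - z *: x) = x &
          forall x, A (S x) - z *: S x = x]].

Definition poly_op (R : realType) (H : completeNormedModType R[i])
    (p : {poly R[i]}) (A : {linear H -> H}) (x : H) : H :=
  \sum_(k < size p) p`_k *: iter k A x.

(* Continuous functional calculus of a bounded self-adjoint operator A: T = f(A)
   when T is the norm limit of p_n(A) for polynomials p_n converging to f
   uniformly on the spectrum of A.  That spectrum is contained in the real line,
   so only its real points need to be considered. *)
Definition is_fun_calc (R : realType) (H : completeNormedModType R[i])
    (f : R -> R[i]) (A : {linear H -> H}) (T : {linear H -> H}) : Prop :=
  bounded_op T /\
  exists p : nat -> {poly R[i]},
    {uniform [set t : R | spectrum A t%:C],
      (fun n (t : R) => (p n).[t%:C] : R[i]^o) @ \oo --> (f : R -> R[i]^o)} /\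
    (fun n => opnorm (T \- poly_op (p n) A)) @ \oo --> (0 : R).

(* For A bounded and self-adjoint and f continuous there is exactly one T with
   is_fun_calc f A T; the zero operator is a default value for other arguments. *)
Definition fun_calc (R : realType) (H : completeNormedModType R[i])
    (f : R -> R[i]) (A : {linear H -> H}) : {linear H -> H} :=
  xget (\0 : {linear H -> H}) [set T | is_fun_calc f A T].

(* Main.v *)
(* Cover the spectra of A and B by hat functions p_i = q_i^2 of mesh s, with
   sum_i p_i = 1, and cut R into the blocks q_i(A) R q_j(B).  If |i - j| > 2, then
   on such a block A and B act as two scalars at least 3 s apart, up to errors of
   norm s each, so the Sylvester equation bounds the block by |AR - RB| / s.
   Let R_s be the sum of the p_i(A) R p_j(B) with |i - j| <= 2.  There f varies by
   O(s^alpha), so a Schur test gives |f(A) R_s - R_s f(B)| = O(s^alpha |R|).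
   The increment R_(4s) - R_s only involves blocks with 2 < |i - j| < 18 at mesh
   s, so it contributes O(s^alpha |AR - RB| / s).  Summing over
   s = delta, 4 delta, 16 delta, ... gives a geometric series since alpha < 1, and
   R_s = R for large s.  Finally take delta = |AR - RB| / |R|. *)
From HB Require Import structures.
Require Import Defs.
From mathcomp Require Import all_boot all_order all_algebra complex.
From mathcomp Require Import all_classical all_reals all_analysis.
From mathcomp Require Import ring lra zify.
Import Order.TTheory GRing.Theory Num.Theory numFieldNormedType.Exports.

Set Implicit Arguments.
Unset Strict Implicit.
Unset Printing Implicit Defensive.

Local Open Scope ring_scope.
Local Open Scope complex_scope.

(** * Real-valued norms *)

(** A band of width D costs a factor (2 D + 1)(D + 2) in the commutator estimate, so no single mesh
    can treat all blocks: a far block is charged to the scale at which it lies at bounded distance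
    from the diagonal. The square roots serve the Schur test. Since p_i(A) R p_j(B) = q_i(A)
    [q_i(A) R q_j(B)] q_j(B), the outer factors have squares summing to 1 while the bracket carries
    the norm bound, and the cost depends on the width of the band but not on the number of blocks.
    Replacing f by its value at a node leaves (f - f(node)) q_i, whose squares sum to at most (c
    s^alpha)^2, so the same test covers the error terms. The value of delta balances the starting
    term |R| delta^alpha against the series |AR - RB| delta^(alpha - 1). Since f(A) is defined by
    norm limits of polynomials, the calculus rests on one inequality, |p(A)| <= sup |p| over the
    real points of the spectrum; it is obtained without spectral measures, from factorization of
    polynomials and lower bounds |T x| >= c |x|. *)

Section RealNorm.
Variable R : realType.

(** Norms live in [R[i]], whose order is partial; estimates are made on the real part, which [normE]
    shows to be the whole norm. *)
Definition rnorm (V : normedZmodType R[i]) (v : V) : R := complex.Re `|v|.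

Lemma realcD (a b : R) : (a + b)%:C = a%:C + b%:C. Proof. exact: rmorphD. Qed.
Lemma realcB (a b : R) : (a - b)%:C = a%:C - b%:C. Proof. exact: rmorphB. Qed.
Lemma realcM (a b : R) : (a * b)%:C = a%:C * b%:C. Proof. exact: rmorphM. Qed.
Lemma realcX (a : R) n : (a ^+ n)%:C = a%:C ^+ n. Proof. exact: rmorphXn. Qed.
Lemma realcV (a : R) : a^-1%:C = a%:C^-1. Proof. exact: fmorphV. Qed.

Section NormedZmod.
Variable V : normedZmodType R[i].
Implicit Types u v : V.

Lemma normE v : `|v| = (rnorm v)%:C.
Proof. by rewrite /rnorm RRe_real// normr_real. Qed.

Lemma rnorm_ge0 v : 0 <= rnorm v.
Proof. by rewrite -ler0c -normE normr_ge0. Qed.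

Lemma norm_le_real v (c : R) : (`|v| <= c%:C) = (rnorm v <= c).
Proof. by rewrite normE lecR. Qed.

Lemma norm_le1 v : (`|v| <= 1) = (rnorm v <= 1).
Proof. exact: norm_le_real. Qed.

Lemma rnormD u v : rnorm (u + v) <= rnorm u + rnorm v.
Proof. by rewrite -lecR realcD -!normE ler_normD. Qed.

Lemma rnormN v : rnorm (- v) = rnorm v.
Proof. by rewrite /rnorm normrN. Qed.

Lemma rnormB u v : rnorm (u - v) <= rnorm u + rnorm v.
Proof. by rewrite (le_trans (rnormD _ _))// rnormN. Qed.

Lemma rnorm_distC u v : rnorm (u - v) = rnorm (v - u).
Proof. by rewrite -rnormN opprB. Qed.

Lemma rnorm0 : rnorm (0 : V) = 0.
Proof. by rewrite /rnorm normr0. Qed.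

Lemma rnorm_eq0 v : (rnorm v == 0) = (v == 0).
Proof. by rewrite -[in RHS]normr_eq0 normE -[0 in RHS]/(0%:C) (inj_eq (@complexI R)). Qed.

Lemma rnorm_sum (I : finType) (P : pred I) (F : I -> V) :
  rnorm (\sum_(i | P i) F i) <= \sum_(i | P i) rnorm (F i).
Proof.
elim/big_ind2 : _ => [|u r v s ur vs|//]; first by rewrite rnorm0.
by rewrite (le_trans (rnormD _ _))// lerD.
Qed.

End NormedZmod.

Lemma rnormZ (V : normedModType R[i]) (a : R[i]) (v : V) :
  rnorm (a *: v) = rnorm a * rnorm v.
Proof. by apply: (@complexI R); rewrite realcM -!normE normrZ. Qed.

Lemma rnormM (a b : R[i]) : rnorm (a * b) = rnorm a * rnorm b.
Proof. by apply: (@complexI R); rewrite realcM -!normE normrM. Qed.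

Lemma rnorm_real (r : R) : rnorm r%:C = `|r|.
Proof. by rewrite /rnorm normc_def /= expr0n addr0 sqrtr_sqr. Qed.

Lemma rnormJ (a : R[i]) : rnorm (Num.conj a) = rnorm a.
Proof. by rewrite /rnorm norm_conjC. Qed.

Lemma rnormK (a : R[i]) : a * Num.conj a = (rnorm a ^+ 2)%:C.
Proof. by rewrite -normCK normE realcX. Qed.

Lemma Im_le_rnorm (a : R[i]) : `|complex.Im a| <= rnorm a.
Proof.
rewrite /rnorm normc_def /= -sqrtr_sqr ler_wsqrtr//.
by rewrite lerDr sqr_ge0.
Qed.

End RealNorm.

Section Operators.
Variables (R : realType) (H : completeNormedModType R[i]).
Implicit Types (T S : H -> H) (c d : R) (x y : H).

(** An explicit bound in place of [opnorm]: it adds and composes with no boundedness hypothesis,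
    whereas [opnorm] is meaningful only once boundedness is known. *)
Definition opbound T c := forall x, rnorm (T x) <= c * rnorm x.

Lemma opbound_le T c d : c <= d -> opbound T c -> opbound T d.
Proof.
by move=> cd Tc x; rewrite (le_trans (Tc x))// ler_wpM2r// rnorm_ge0.
Qed.

Lemma opbound_comp T S c d : 0 <= c ->
  opbound T c -> opbound S d -> opbound (T \o S) (c * d).
Proof.
move=> c0 Tc Sd x; rewrite (le_trans (Tc _))// -mulrA ler_wpM2l//.
Qed.

Lemma opboundD T S c d :
  opbound T c -> opbound S d -> opbound (T \+ S) (c + d).
Proof. by move=> Tc Sd x; rewrite (le_trans (rnormD _ _))// mulrDl lerD. Qed.

Lemma opboundN T c : opbound T c -> opbound (fun x => - T x) c.
Proof. by move=> Tc x; rewrite rnormN. Qed.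

Lemma opboundB T S c d :
  opbound T c -> opbound S d -> opbound (T \- S) (c + d).
Proof. by move=> Tc Sd; apply: opboundD => //; exact: opboundN. Qed.

Lemma opbound0 T : opbound T 0 -> forall x, T x = 0.
Proof.
move=> T0 x; apply/eqP; rewrite -rnorm_eq0 eq_le rnorm_ge0 andbT.
by rewrite (le_trans (T0 x))// mul0r.
Qed.

Lemma opbound_small T : (forall e, 0 < e -> opbound T e) -> forall x, T x = 0.
Proof.
move=> Te; apply: opbound0 => x; rewrite mul0r; apply/ler_addgt0Pr => e e0.
rewrite add0r; have x1 : 0 < rnorm x + 1 by rewrite ltr_pwDr ?rnorm_ge0.
rewrite (le_trans (Te (e / (rnorm x + 1)) _ x)) ?divr_gt0//.
by rewrite mulrAC ler_pdivrMr// ler_wpM2l ?(ltW e0)// lerDl.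
Qed.

Lemma opbound_approx T c : (forall e, 0 < e -> opbound T (c + e)) -> opbound T c.
Proof.
move=> Te x; apply/ler_addgt0Pr => e e0.
have x1 : 0 < rnorm x + 1 by rewrite ltr_pwDr ?rnorm_ge0.
rewrite (le_trans (Te (e / (rnorm x + 1)) _ x)) ?divr_gt0// mulrDl lerD2l.
by rewrite mulrAC ler_pdivrMr// ler_wpM2l ?(ltW e0)// lerDl.
Qed.

Lemma bounded_opP T : bounded_op T <->
  exists c, forall x, rnorm x <= 1 -> rnorm (T x) <= c.
Proof.
split.
  case=> M [Mreal hM]; exists (complex.Re M + 1) => x x1.
  have /= := hM (M + 1) _ x; rewrite ltrDl ltr01 => /(_ erefl).
  rewrite norm_le1 => /(_ x1); rewrite -[M]RRe_real//.
  by rewrite -[1]/(1%:C) -realcD norm_le_real.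
case=> c hc; exists c%:C; split; first by apply/complex_realP; exists c.
move=> N cN x /=; rewrite norm_le1 => x1.
by rewrite (le_trans _ (ltW cN))// norm_le_real hc.
Qed.

Lemma opnorm_le T c : (forall x, rnorm x <= 1 -> rnorm (T x) <= c) -> opnorm T <= c.
Proof.
move=> hc; apply: ge_sup.
  by exists (rnorm (T 0)), 0 => //=; rewrite normr0.
move=> _ [x /= x1 <-]; apply: hc.
by rewrite -norm_le1.
Qed.

Lemma opbound_bounded_op T c : 0 <= c -> opbound T c -> bounded_op T.
Proof.
move=> c0 Tc; apply/bounded_opP; exists c => x x1.
by rewrite (le_trans (Tc x))// ler_piMr.
Qed.

Lemma opbound_opnorm_le T c : 0 <= c -> opbound T c -> opnorm T <= c.
Proof.
move=> c0 Tc; apply: opnorm_le => x x1.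
by rewrite (le_trans (Tc x))// ler_piMr.
Qed.

Section Bounded.
Variable T : H -> H.
Hypotheses (TZ : forall a x, T (a *: x) = a *: T x) (Tb : bounded_op T).

Let ball_le x : rnorm x <= 1 -> rnorm (T x) <= opnorm T.
Proof.
move=> x1; apply: ub_le_sup.
  have /bounded_opP[c hc] := Tb.
  exists c => _ [y /= y1 <-]; apply: hc.
  by rewrite -norm_le1.
by exists x => //=; rewrite norm_le1.
Qed.

Lemma opnorm_ge0 : 0 <= opnorm T.
Proof. by rewrite (le_trans (rnorm_ge0 (T 0)))// ball_le// rnorm0. Qed.

Lemma opnormP : opbound T (opnorm T).
Proof.
move=> x; have [->|x0] := eqVneq x 0.
  by have := TZ 0 0; rewrite !scale0r => ->; rewrite rnorm0 mulr0.
have nx : 0 < rnorm x by rewrite lt_def rnorm_ge0 rnorm_eq0 x0.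
have := ball_le (x := ((rnorm x)^-1)%:C *: x).
rewrite TZ !rnormZ rnorm_real ger0_norm ?invr_ge0 ?rnorm_ge0//.
rewrite mulVf ?gt_eqF// => /(_ (lexx _)).
by rewrite mulrC ler_pdivrMr.
Qed.

End Bounded.

Lemma linear_opnormP (T : {linear H -> H}) :
  bounded_op T -> opbound T (opnorm T).
Proof. by apply: opnormP => a x; rewrite linearZ. Qed.
End Operators.

(** * Inner product and Cauchy-Schwarz inequality *)

Section Inner.
Variables (R : realType) (H : completeNormedModType R[i]).
Variable dot : {dot H for @Num.conj R[i]}.
Hypothesis dotE : hilbert_norm dot.
Implicit Types x y z : H.

Lemma dot_rnorm x : dot x x = (rnorm x ^+ 2)%:C.
Proof. by rewrite -dotE normE realcX. Qed.

Lemma dotC x y : dot x y = Num.conj (dot y x).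
Proof. by rewrite (hermC dot) expr0 mul1r. Qed.

Lemma dotBl x y z : dot (x - y) z = dot x z - dot y z.
Proof. exact: linearBl. Qed.
Lemma dotBr x y z : dot z (x - y) = dot z x - dot z y.
Proof. exact: linearBr. Qed.
Lemma dotDl x y z : dot (x + y) z = dot x z + dot y z.
Proof. exact: linearDl. Qed.
Lemma dotDr x y z : dot z (x + y) = dot z x + dot z y.
Proof. exact: linearDr. Qed.
Lemma dotZl a x z : dot (a *: x) z = a * dot x z.
Proof. exact: linearZl_LR. Qed.
Lemma dotZr a x z : dot z (a *: x) = Num.conj a * dot z x.
Proof. exact: linearZr_LR. Qed.
Lemma dot0l z : dot 0 z = 0.
Proof. exact: linear0l. Qed.
Lemma dot0r z : dot z 0 = 0.
Proof. exact: linear0r. Qed.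

Lemma dot_suml (I : finType) (P : pred I) (F : I -> H) z :
  dot (\sum_(i | P i) F i) z = \sum_(i | P i) dot (F i) z.
Proof.
by elim/big_ind2 : _ => [|u r v s ur vs|//]; rewrite ?dot0l// dotDl ur vs.
Qed.

Lemma dot_sumr (I : finType) (P : pred I) (F : I -> H) z :
  dot z (\sum_(i | P i) F i) = \sum_(i | P i) dot z (F i).
Proof.
by elim/big_ind2 : _ => [|u r v s ur vs|//]; rewrite ?dot0r// dotDr ur vs.
Qed.

Lemma dot_conj_rnorm x y : dot x y * dot y x = (rnorm (dot x y) ^+ 2)%:C.
Proof. by rewrite [dot y x]dotC rnormK. Qed.

Lemma cauchy_schwarz x y : rnorm (dot x y) <= rnorm x * rnorm y.
Proof.
have [->|y0] := eqVneq y 0; first by rewrite dot0r !rnorm0 mulr0.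
have ny : 0 < rnorm y by rewrite lt_def rnorm_ge0 rnorm_eq0 y0.
rewrite -(@ler_pXn2r _ 2) ?nnegrE ?mulr_ge0 ?rnorm_ge0// exprMn.
pose a := dot x y / (rnorm y ^+ 2)%:C.
have a0 : (rnorm y ^+ 2)%:C != 0 :> R[i].
  by rewrite -[0]/(0%:C) (inj_eq (@complexI R)) expf_neq0// gt_eqF.
have : 0 <= dot (x - a *: y) (x - a *: y) by exact: dnorm_ge0.
have -> : dot (x - a *: y) (x - a *: y) =
    (rnorm x ^+ 2 - rnorm (dot x y) ^+ 2 / rnorm y ^+ 2)%:C.
  rewrite dotBl !dotBr !dotZl !dotZr !dot_rnorm.
  have -> : a * (Num.conj a * (rnorm y ^+ 2)%:C) = Num.conj a * dot x y.
    by rewrite /a mulrCA mulfVK.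
  rewrite opprB addrA subrK realcB realcM -(dot_conj_rnorm x y) realcV.
  by rewrite /a mulrAC.
by rewrite ler0c subr_ge0 ler_pdivrMr ?exprn_gt0.
Qed.

Lemma rnorm_sqrB x y :
  rnorm (x - y) ^+ 2 = rnorm x ^+ 2 + rnorm y ^+ 2 - 2 * complex.Re (dot x y).
Proof.
apply: (@complexI R); rewrite -dot_rnorm dotBl !dotBr !dot_rnorm [dot y x]dotC.
rewrite realcB realcD.
rewrite [(2 * _)%:C]realcM [2%:C]rmorph_nat.
have := addcJ (dot x y); rewrite -[(dot x y)^*%C]/(Num.conj (dot x y)) => <-.
by ring.
Qed.

End Inner.

(** * Polynomials of an operator and the spectral bound *)

Section PolyOp.
Variables (R : realType) (H : completeNormedModType R[i]).
Implicit Types (A : {linear H -> H}) (p q r : {poly R[i]}) (x y : H).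

Lemma poly_op_widen p A n x : (size p <= n)%N ->
  poly_op p A x = \sum_(k < n) p`_k *: iter k A x.
Proof.
move=> pn; rewrite /poly_op (big_ord_widen _ (fun k => p`_k *: iter k A x) pn).
rewrite big_mkcond; apply: eq_bigr => k _; case: ltnP => // kp.
by rewrite nth_default// scale0r.
Qed.

Lemma iter_is_linear A k : linear (iter k A : H -> H).
Proof. by elim: k => // k IH a x y; rewrite !iterS IH linearP. Qed.

Lemma poly_op_is_linear p A : linear (poly_op p A).
Proof.
move=> a x y; rewrite /poly_op scaler_sumr -big_split/=; apply: eq_bigr => k _.
by rewrite iter_is_linear scalerDr !scalerA mulrC.
Qed.

HB.instance Definition _ p A :=
  GRing.isLinear.Build R[i] H H *:%R (poly_op p A) (poly_op_is_linear p A).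

Lemma poly_opD p q A x : poly_op (p + q) A x = poly_op p A x + poly_op q A x.
Proof.
set n := maxn (size p) (size q).
rewrite (@poly_op_widen p A n) ?leq_maxl// (@poly_op_widen q A n) ?leq_maxr//.
rewrite (@poly_op_widen _ A n) ?size_polyD// -big_split; apply: eq_bigr => k _.
by rewrite coefD scalerDl.
Qed.

Lemma poly_opZ a p A x : poly_op (a *: p) A x = a *: poly_op p A x.
Proof.
rewrite (@poly_op_widen _ A (size p)) ?size_scale_leq// scaler_sumr.
by apply: eq_bigr => k _; rewrite coefZ scalerA.
Qed.

Lemma poly_opB p q A x : poly_op (p - q) A x = poly_op p A x - poly_op q A x.
Proof. by rewrite poly_opD -scaleN1r poly_opZ scaleN1r. Qed.

Lemma poly_op0 A x : poly_op 0 A x = 0.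
Proof. by rewrite /poly_op size_poly0 big_ord0. Qed.

Lemma poly_opC c A x : poly_op c%:P A x = c *: x.
Proof.
by rewrite (@poly_op_widen _ A 1) ?size_polyC_leq1// big_ord1 coefC.
Qed.

Lemma poly_opMX p A x : poly_op (p * 'X) A x = poly_op p A (A x).
Proof.
rewrite (@poly_op_widen _ A (size p).+1); last first.
  by have [->|p0] := eqVneq p 0; rewrite ?mul0r ?size_poly0// size_mulX.
rewrite big_ord_recl coefMX/= scale0r add0r; apply: eq_bigr => k _.
by rewrite coefMX/= -iterS iterSr.
Qed.

Lemma poly_opX A x : poly_op 'X A x = A x.
Proof. by rewrite -['X]mul1r poly_opMX poly_opC scale1r. Qed.

Lemma poly_opM p q A x : poly_op (p * q) A x = poly_op p A (poly_op q A x).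
Proof.
elim/poly_ind: q x => [|q c IH] x.
  by rewrite mulr0 !poly_op0 linear0.
rewrite mulrDr mulrA !poly_opD !poly_opMX IH linearD/=; congr (_ + _).
by rewrite mulrC mul_polyC poly_opZ poly_opC linearZ.
Qed.

Lemma poly_op_opbound p A M : 0 <= M -> opbound A M ->
  exists2 c, 0 <= c & opbound (poly_op p A) c.
Proof.
move=> M0 AM; exists (\sum_(k < size p) rnorm p`_k * M ^+ k).
  by apply: sumr_ge0 => k _; rewrite mulr_ge0 ?rnorm_ge0 ?exprn_ge0.
move=> x; rewrite (le_trans (rnorm_sum _ _))// mulr_suml ler_sum// => k _.
rewrite rnormZ -mulrA ler_wpM2l ?rnorm_ge0//.
elim: (nat_of_ord k) => [|j IH] /=; first by rewrite mul1r.
by rewrite (le_trans (AM _))// exprS -mulrA ler_wpM2l.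
Qed.

(** Stands in for invertibility: it is stable under composition, and its failure for A - z is enough
    to place z in the spectrum. *)
Definition bounded_below (T : H -> H) :=
  exists2 c : R, 0 < c & forall x, c * rnorm x <= rnorm (T x).

(** Over [R[i]] the polynomial splits into linear factors, and the lower bounds of the factors
    multiply. *)
Lemma bounded_below_poly_op r A : r != 0 ->
  (forall z, root r z -> bounded_below (fun x => A x - z *: x)) ->
  bounded_below (poly_op r A).
Proof.
move=> r0; have [s rE] := closed_field_poly_normal r.
have l0 : lead_coef r != 0 by rewrite lead_coef_eq0.
move=> zb; have {}zb z : z \in s -> bounded_below (fun x => A x - z *: x).
  by move=> zs; apply: zb; rewrite rE rootZ// root_prod_XsubC.
have [c c0 cb] : bounded_below (poly_op (\prod_(z <- s) ('X - z%:P)) A).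
  elim: s zb {rE} => [_|z s IH zb].
    by exists 1 => // x; rewrite big_nil poly_opC scale1r mul1r.
  have [c c0 cb] : bounded_below (poly_op ('X - z%:P) A).
    have [c c0 cb] := zb z (mem_head _ _); exists c => // x.
    by rewrite poly_opB poly_opX poly_opC cb.
  have [|d d0 db] := IH; first by move=> w ws; apply: zb; rewrite in_cons ws orbT.
  exists (c * d); first by rewrite mulr_gt0.
  move=> x; rewrite big_cons poly_opM (le_trans _ (cb _))// -mulrA.
  by rewrite ler_wpM2l// ltW.
exists (rnorm (lead_coef r) * c).
  by rewrite mulr_gt0// lt_def rnorm_ge0 rnorm_eq0 l0.
by move=> x; rewrite [in leRHS]rE poly_opZ rnormZ -mulrA ler_wpM2l// rnorm_ge0.
Qed.

(** [S] is the resolvent: |x| = |S (A x - z x)| <= |S| |A x - z x|. The summand 1 in the constant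
    covers [opnorm S = 0]. *)
Lemma bounded_below_notin_spectrum A z :
  ~ spectrum A z -> bounded_below (fun x => A x - z *: x).
Proof.
move=> /contrapT[S [Sb SA _]].
have S0 := opnorm_ge0 Sb.
exists (opnorm S + 1)^-1; first by rewrite invr_gt0 ltr_wpDl.
move=> x; rewrite mulrC ler_pdivrMr ?ltr_wpDl// -[in leLHS](SA x).
rewrite (le_trans (linear_opnormP Sb _))// mulrC ler_wpM2l ?rnorm_ge0//.
by rewrite lerDl.
Qed.

End PolyOp.

(** * Norm of a polynomial in a self-adjoint operator *)

Section SpectralBound.
Variables (R : realType) (H : completeNormedModType R[i]).
Variable dot : {dot H for @Num.conj R[i]}.
Hypothesis dotE : hilbert_norm dot.
Implicit Types x y z : H.

(** The imaginary part of <(A - z) x, x> is - Im z |x|^2, because <A x, x> is real; Cauchy-Schwarz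
    concludes. *)
Lemma selfadjoint_bounded_below (A : {linear H -> H}) (z : R[i]) :
  selfadjoint dot A -> complex.Im z != 0 ->
  bounded_below (fun x => A x - z *: x).
Proof.
move=> Asa z0; exists `|complex.Im z|; first by rewrite normr_gt0.
move=> x; have [->|x0] := eqVneq x 0; first by rewrite rnorm0 mulr0 rnorm_ge0.
have nx : 0 < rnorm x by rewrite lt_def rnorm_ge0 rnorm_eq0 x0.
rewrite -(ler_pM2r nx); apply: le_trans (cauchy_schwarz dotE _ _).
apply: le_trans (Im_le_rnorm _).
have AxI : complex.Im (dot (A x) x) = 0.
  have : dot (A x) x = Num.conj (dot (A x) x) by rewrite -(dotC dot) Asa.
  by case: (dot (A x) x) => a b /= [] /eqP; rewrite -addr_eq0 -mulr2n mulrn_eq0 => /eqP.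
rewrite dotBl dotZl (dot_rnorm dotE) raddfB/= AxI sub0r normrN.
by case: z {z0} => a b /=; rewrite mulr0 add0r normrM (ger0_norm (sqr_ge0 _)) expr2 mulrA.
Qed.

Lemma adjoint_opbound (T S : H -> H) c : 0 <= c -> opbound T c ->
  (forall x y, dot (T x) y = dot x (S y)) -> opbound S c.
Proof.
move=> c0 Tc TS y; have [->|y0] := eqVneq (S y) 0.
  by rewrite rnorm0 mulr_ge0 ?rnorm_ge0.
have ny : 0 < rnorm (S y) by rewrite lt_def rnorm_ge0 rnorm_eq0 y0.
rewrite -(ler_pM2r ny) -expr2.
have -> : rnorm (S y) ^+ 2 = rnorm (dot (S y) (S y)).
  by rewrite (dot_rnorm dotE) rnorm_real ger0_norm// sqr_ge0.
rewrite -TS (le_trans (cauchy_schwarz dotE _ _))//.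
by rewrite mulrAC ler_wpM2r ?rnorm_ge0.
Qed.

(* The operator norm of [T] is an approximate singular value of [T]. *)
Lemma adjoint_comp_not_bounded_below (T S : H -> H) :
  (forall a x, T (a *: x) = a *: T x) -> bounded_op T -> 0 < opnorm T ->
  (forall x y, dot (T x) y = dot x (S y)) ->
  ~ bounded_below (fun x => S (T x) - ((opnorm T) ^+ 2)%:C *: x).
Proof.
move=> TZ Tb; set L := opnorm T => L0 TS [c c0 cb].
have TL : opbound T L by exact: opnormP.
have SL := adjoint_opbound (ltW L0) TL TS.
have L20 : 0 < L ^+ 2 by rewrite exprn_gt0.
(* Expanding |S T x - L^2 x|^2 and using |S T x| <= L |T x| turns the lower bound [cb] into a bound
   on T strictly below its norm L. *)
have key x : rnorm (T x) ^+ 2 <= (L ^+ 2 - c ^+ 2 / L ^+ 2) * rnorm x ^+ 2.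
  have : (c * rnorm x) ^+ 2 <= L ^+ 2 * rnorm (T x) ^+ 2 + (L ^+ 2 * rnorm x) ^+ 2
      - 2 * (L ^+ 2 * rnorm (T x) ^+ 2).
    have le2 a b : 0 <= a -> a <= b -> a ^+ 2 <= b ^+ 2 :> R.
      by move=> a0 ab; rewrite ler_pXn2r ?nnegrE// (le_trans a0).
    rewrite (le_trans (le2 _ _ _ (cb x))) ?mulr_ge0 ?rnorm_ge0 ?(ltW c0)//.
    rewrite (rnorm_sqrB dotE) rnormZ rnorm_real ger0_norm ?(ltW L20)// dotZr.
    have -> : Num.conj (L ^+ 2)%:C = (L ^+ 2)%:C by exact: conjc_real.
    have -> : dot (S (T x)) x = (rnorm (T x) ^+ 2)%:C.
      by rewrite (dotC dot) -TS (dot_rnorm dotE); exact: conjc_real.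
    rewrite -realcM /= lerD2r lerD2r -exprMn.
    by apply: le2; rewrite ?rnorm_ge0 ?SL.
  have dE : L ^+ 2 * (c ^+ 2 / L ^+ 2) = c ^+ 2 by rewrite mulrC mulfVK ?gt_eqF.
  move=> h; rewrite -(ler_pM2l L20) [leRHS]mulrA mulrBr dE.
  nra.
pose m := Num.sqrt (L ^+ 2 - c ^+ 2 / L ^+ 2).
have Lm : L <= m.
  apply: opbound_opnorm_le; first exact: sqrtr_ge0.
  move=> x; rewrite /m -[rnorm x]ger0_norm ?rnorm_ge0// -sqrtr_sqr mulrC.
  rewrite -sqrtrM ?sqr_ge0// mulrC -[leLHS]ger0_norm ?rnorm_ge0// -sqrtr_sqr.
  exact: ler_wsqrtr.
have m0 : 0 < m by exact: lt_le_trans Lm.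
have a0 : 0 < L ^+ 2 - c ^+ 2 / L ^+ 2 by rewrite -sqrtr_gt0.
have : L ^+ 2 <= m ^+ 2 by rewrite ler_pXn2r// nnegrE ltW.
rewrite sqr_sqrtr ?(ltW a0)//; apply/negP; rewrite -ltNge gtrBl.
by rewrite divr_gt0// exprn_gt0.
Qed.

Variable A : {linear H -> H}.
Hypotheses (Ab : bounded_op A) (Asa : selfadjoint dot A).

Lemma dot_poly_op p x y :
  dot (poly_op p A x) y = dot x (poly_op (map_poly Num.conj p) A y).
Proof.
rewrite /poly_op size_map_poly dot_suml dot_sumr; apply: eq_bigr => k _.
rewrite dotZl dotZr coef_map/= conjCK; congr (_ * _).
elim: (nat_of_ord k) x y => // j IH x y.
by rewrite [in LHS]iterS Asa IH -iterSr.
Qed.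

Lemma horner_conj_real (p : {poly R[i]}) (t : R) :
  (map_poly Num.conj p).[t%:C] = Num.conj p.[t%:C].
Proof.
have tE : t%:C = Num.conj t%:C :> R[i] by exact/esym/conjc_real.
by rewrite [in LHS]tE horner_map.
Qed.

(** Contrapositive of [bounded_below_poly_op]: some root must fail to give a lower bound;
    self-adjointness makes it real and the resolvent bound places it in the spectrum. *)
Lemma spectrum_root r : r != 0 -> ~ bounded_below (poly_op r A) ->
  exists2 t : R, spectrum A t%:C & root r t%:C.
Proof.
move=> r0 rb; apply: contrapT => nt; apply: rb.
apply: bounded_below_poly_op => // z rz.
have [zI|/eqP zI] := eqVneq (complex.Im z) 0; last first.
  by apply: selfadjoint_bounded_below => //; exact/eqP.
apply: bounded_below_notin_spectrum => zs; apply: nt.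
have zE : z = (complex.Re z)%:C by case: z zI {rz zs} => a b /= ->.
by exists (complex.Re z); rewrite -zE.
Qed.

(** [spectrum_root] for X^2 - |A|^2: A is its own adjoint, so A^2 - |A|^2 is not bounded below. The
    case A = 0 is separate and uses the nonzero vector [x]. *)
Lemma spectrum_nonempty x : x != 0 -> exists t : R, spectrum A t%:C.
Proof.
move=> x0; have L0 := opnorm_ge0 Ab; set L := opnorm A in L0.
have [||t ts _] := @spectrum_root ('X^2 - (L ^+ 2)%:C%:P).
- by rewrite -size_poly_eq0 size_XnsubC.
- have rE y : poly_op ('X^2 - (L ^+ 2)%:C%:P) A y = A (A y) - (L ^+ 2)%:C *: y.
    by rewrite poly_opB poly_opC expr2 poly_opM !poly_opX.
  case=> c c0 cb; have [Lpos|] := ltP 0 L.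
    apply: (@adjoint_comp_not_bounded_below A A) => // [a y|].
      by rewrite linearZ.
    by exists c => // y; rewrite -rE.
  move=> Lneg; have A0 y : A y = 0.
    apply: opbound0; exact: opbound_le Lneg (linear_opnormP Ab).
  have L00 : L = 0 by apply/eqP; rewrite eq_le Lneg.
  have := cb x; rewrite rE A0 L00 expr0n scale0r subrr rnorm0.
  by rewrite pmulr_rle0// leNgt lt_def rnorm_ge0 rnorm_eq0 x0.
by exists t.
Qed.

(** For T = p(A) with adjoint T', the operator T' T - |T|^2 is r(A) for a polynomial r and is not
    bounded below. So r has a root t in the spectrum, which says |p(t)| = |T|. *)
Lemma poly_op_spectral_bound (p : {poly R[i]}) c : 0 <= c ->
  (forall t : R, spectrum A t%:C -> rnorm p.[t%:C] <= c) ->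
  opbound (poly_op p A) c.
Proof.
move=> c0 pc; set T := poly_op p A.
have Tb : bounded_op T.
  have [//||d d0 Td] := @poly_op_opbound _ _ p A (opnorm A).
  - exact: opnorm_ge0.
  - exact: linear_opnormP.
  exact: opbound_bounded_op d0 Td.
have TZ a x : T (a *: x) = a *: T x by exact: linearZ.
apply: (@opbound_le _ _ _ (opnorm T)); last exact: opnormP.
rewrite leNgt; apply/negP => cL.
have L0 : 0 < opnorm T by exact: le_lt_trans cL.
pose r := map_poly Num.conj p * p - (opnorm T ^+ 2)%:C%:P.
have [t ts rt] : exists2 t : R, spectrum A t%:C & root r t%:C.
  (* If [r] is zero every point is a root, and only some spectral point is wanted; this needs [H]
     nonzero, which follows from [opnorm T > 0]. *)
  have [r0|r0] := eqVneq r 0.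
    have [x x0] : exists x : H, x != 0.
      apply: contrapT => nx; suff : opnorm T <= 0 by rewrite leNgt L0.
      apply: opbound_opnorm_le => // x; have [->|x0] := eqVneq x 0.
        by rewrite /T linear0 rnorm0 mul0r.
      by exfalso; apply: nx; exists x.
    by have [t ts] := spectrum_nonempty x0; exists t; rewrite // r0 root0.
  apply: spectrum_root => // -[d d0 db].
  apply: (@adjoint_comp_not_bounded_below T (poly_op (map_poly Num.conj p) A)) => //.
    exact: dot_poly_op.
  by exists d => // x; rewrite -poly_opM -(poly_opC _ A) -poly_opB.
have : rnorm p.[t%:C] = opnorm T.
  apply/eqP; rewrite -(@eqrXn2 _ 2) ?rnorm_ge0 ?ltW//; apply/eqP/(@complexI R).
  move: rt; rewrite /r /root hornerD hornerN hornerM hornerC horner_conj_real.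
  by rewrite mulrC rnormK subr_eq0 => /eqP.
by move=> E; have := pc _ ts; rewrite E leNgt cL.
Qed.

End SpectralBound.

(** * Bernstein polynomials *)

Section Weierstrass.
Variable R : realType.

(** Bounded and uniformly continuous on [[-M, M]], stated in the form in which it is used, so that
    no compactness argument is needed. *)
Definition ucontb (M : R) (g : R -> R[i]) :=
  (exists c : R, forall x : R, `|x| <= M -> rnorm (g x) <= c) /\
  forall e : R, 0 < e -> exists2 d : R, 0 < d & forall x y : R,
    `|x| <= M -> `|y| <= M -> `|x - y| <= d -> rnorm (g x - g y) <= e.

(* The mean of [phi] under the binomial law with parameters [n] and [u], by
   conditioning on one trial: no binomial coefficient is needed. *)
Fixpoint binom_mean n (phi : nat -> R) (u : R) : R :=
  if n is m.+1 then
    u * binom_mean m (phi \o S) u + (1 - u) * binom_mean m phi u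
  else phi 0.

(** The recursion of [binom_mean] with a polynomial [U] for the probability; [weierstrass] takes for
    [U] the affine map of [[-M, M]] onto [[0, 1]]. *)
Fixpoint bernstein (U : {poly R[i]}) n (phi : nat -> R[i]) : {poly R[i]} :=
  if n is m.+1 then U * bernstein U m (phi \o S) + (1 - U) * bernstein U m phi
  else (phi 0)%:P.

Lemma binom_mean_affine n phi a b u :
  binom_mean n (fun k => a + b * phi k) u = a + b * binom_mean n phi u.
Proof.
elim: n phi => //= n IH phi.
by rewrite IH (IH (phi \o S)); ring.
Qed.

Lemma binom_mean_le n phi psi u : 0 <= u <= 1 ->
  (forall k, (k <= n)%N -> phi k <= psi k) ->
  binom_mean n phi u <= binom_mean n psi u.
Proof.
move=> /andP[u0 u1]; elim: n phi psi => [|n IH] phi psi hle /=; first exact: hle.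
rewrite lerD// ler_wpM2l ?subr_ge0//; apply: IH => k kn; apply: hle => //.
exact: leqW.
Qed.

(** Squared mean plus variance. The shift [a] is kept free because conditioning on a success turns
    it into [a + 1]. *)
Lemma binom_mean_sqr n a u :
  binom_mean n (fun k => (k%:R + a) ^+ 2) u =
  (n%:R * u + a) ^+ 2 + n%:R * u * (1 - u).
Proof.
elim: n a => [|n IH] a /=; first by ring.
rewrite IH.
have -> : (fun k : nat => (k%:R + a) ^+ 2) \o S = fun k => (k%:R + (a + 1)) ^+ 2.
  by apply/funext => k /=; rewrite -natr1; ring.
by rewrite IH -natr1; ring.
Qed.

Lemma bernstein_dist U n phi u z c : 0 <= u <= 1 -> U.[z] = u%:C ->
  rnorm ((bernstein U n phi).[z] - c) <=
  binom_mean n (fun k => rnorm (phi k - c)) u.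
Proof.
move=> /andP[u0 u1] Uz; elim: n phi => [|n IH] phi /=; first by rewrite hornerC.
rewrite hornerD !hornerM hornerD hornerN hornerC Uz.
set p := (bernstein _ _ _).[z]; set q := (bernstein _ _ _).[z].
have -> : u%:C * p + (1 - u%:C) * q - c = u%:C * (p - c) + (1 - u)%:C * (q - c).
  by rewrite realcB; ring.
rewrite (le_trans (rnormD _ _))// !rnormM !rnorm_real !ger0_norm ?subr_ge0//.
by rewrite lerD// ler_wpM2l ?subr_ge0//; apply: IH.
Qed.

(** Bernstein's proof with Chebyshev's inequality: |g(t_k) - g(x)| is at most e / 2 when t_k is
    within [d] of [x], and otherwise at most 2 c <= 2 c (t_k - x)^2 / d^2, whose mean is a
    variance. *)
Lemma weierstrass (M : R) (g : R -> R[i]) (e : R) : 0 < M -> ucontb M g -> 0 < e ->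
  exists p : {poly R[i]}, forall x : R, `|x| <= M -> rnorm (p.[x%:C] - g x) <= e.
Proof.
move=> M0 [[c gc] gu] e0.
have c0 : 0 <= c by rewrite (le_trans (rnorm_ge0 (g 0)))// gc// normr0 ltW.
have [d d0 gd] := gu (e / 2) ltac:(by rewrite divr_gt0).
pose K := 8 * c * M ^+ 2 / d ^+ 2.
have K0 : 0 <= K 
  by rewrite /K divr_ge0 ?sqr_ge0// mulr_ge0 ?sqr_ge0// mulr_ge0.
have [n nK] : exists n : nat, K / (e / 2) < n.+1%:R.
  exists (Num.truncn (K / (e / 2))); exact: truncnS_gt.
pose N : R := n.+1%:R; have N0 : 0 < N by rewrite ltr0n.
pose U : {poly R[i]} := (2 * M)^-1%:C *: ('X + M%:C%:P).
pose t k : R := 2 * M * (k%:R / N) - M.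
exists (bernstein U n.+1 (g \o t)) => x xM.
have /andP[xM1 xM2] : - M <= x <= M by rewrite -ler_norml.
pose u := (2 * M)^-1 * (x + M).
have u01 : 0 <= u <= 1.
  have M20 : 0 < 2 * M by rewrite mulr_gt0.
  rewrite /u mulrC; apply/andP; split; last by rewrite ler_pdivrMr//; lra.
  by rewrite divr_ge0 ?(ltW M20)//; lra.
have xE : x = 2 * M * u - M.
  by rewrite /u mulrA mulfV ?mul1r ?addrK// mulf_neq0 ?gt_eqF.
have UE : U.[x%:C] = u%:C by rewrite hornerZ hornerD hornerX hornerC -realcD -realcM.
rewrite (le_trans (bernstein_dist _ _ _ u01 UE))//.
have -> : e = e / 2 + e / 2 by lra.
(* b (k - N u)^2 is 2 c (t_k - x)^2 / d^2; its mean is (K / N) u (1 - u), which dictates the value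
   of [K]. *)
pose b := 2 * c / d ^+ 2 * (2 * M / N) ^+ 2.
apply: (@le_trans _ _
  (binom_mean n.+1 (fun k => e / 2 + b * (k%:R + - (N * u)) ^+ 2) u)).
  apply: binom_mean_le => // k kn /=.
  have tk : `|t k| <= M.
    have kN : 0 <= k%:R / N <= 1.
      by rewrite divr_ge0 ?ler0n ?(ltW N0)//= ler_pdivrMr// mul1r ler_nat.
    rewrite ler_norml /t; move: (k%:R / N) kN => r /andP[k1 k2].
    by apply/andP; split; nra.
  have b0 : 0 <= b * (k%:R + - (N * u)) ^+ 2.
    by rewrite mulr_ge0 ?sqr_ge0// /b mulr_ge0 ?sqr_ge0// divr_ge0 ?sqr_ge0// mulr_ge0.
  have [td|td] := leP `|t k - x| d.
    by rewrite (le_trans (gd _ _ tk xM td))// lerDl.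
  rewrite (le_trans (rnormB _ _))// ler_wpDl ?divr_ge0 ?(ltW e0)//.
  have -> : b * (k%:R + - (N * u)) ^+ 2 = 2 * c * ((t k - x) ^+ 2 / d ^+ 2).
    by rewrite /b /t xE; field; rewrite !gt_eqF.
  have : 1 <= (t k - x) ^+ 2 / d ^+ 2.
    rewrite ler_pdivlMr ?exprn_gt0// mul1r -[leRHS]real_normK ?num_real//.
    by rewrite ler_pXn2r ?nnegrE ?normr_ge0 ?(ltW d0) ?(ltW td).
  have := gc _ tk; have := gc _ xM; nra.
rewrite binom_mean_affine lerD2l binom_mean_sqr -/N subrr expr0n add0r.
have -> : b * (N * u * (1 - u)) = K / N * (u * (1 - u)).
  by rewrite /b /K; field; rewrite !gt_eqF.
have KN : K / N <= e / 2.
  by rewrite ler_pdivrMr// mulrC -ler_pdivrMr ?divr_gt0// ltW.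
have KN0 : 0 <= K / N by rewrite divr_ge0 ?(ltW N0).
rewrite (le_trans _ KN)// ler_piMr//.
by move/andP: u01 => [u0 u1]; nra.
Qed.

End Weierstrass.

(** * The continuous functional calculus *)

Section FunctionalCalculus.
Variables (R : realType) (H : completeNormedModType R[i]).

(** Completeness of the space of operators, keeping the rate: [T] is the pointwise limit, and
    letting m grow in the Cauchy bound leaves [u n]. *)
Lemma op_limit (L : nat -> {linear H -> H}) (u : nat -> R) :
  (u @ \oo --> (0 : R))%classic ->
  (forall m n, opbound (L m \- L n) (u m + u n)) ->
  exists T : {linear H -> H}, forall n, opbound (T \- L n) (u n).
Proof.
move=> u0 Lu.
have small (x : H) (e : R) : 0 < e -> exists N, forall n, (N <= n)%N -> u n * rnorm x <= e.
  move=> e0; have x1 : 0 < rnorm x + 1 by rewrite ltr_pwDr ?rnorm_ge0.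
  have /cvgrPdist_le/(_ (e / (rnorm x + 1)) ltac:(by rewrite divr_gt0)) := u0.
  case=> N _ hN; exists N => n Nn; have := hN n Nn; rewrite /= sub0r normrN => un.
  rewrite (le_trans (ler_wpM2r (rnorm_ge0 x) (le_trans (ler_norm _) un)))//.
  by rewrite mulrAC ler_pdivrMr// ler_wpM2l ?(ltW e0)// lerDl.
have cv x : cvg (L n x @[n --> \oo])%classic.
  apply/cauchy_cvgP/cauchy_exP => e e0.
  have eE : e = (complex.Re e)%:C by rewrite RRe_real// gtr0_real.
  have {}e0 : 0 < complex.Re e by rewrite -ltcR -eE.
  have [N hN] := small x (complex.Re e / 3) ltac:(by rewrite divr_gt0).
  exists (L N x); exists N => // n /= Nn.
  rewrite -ball_normE/= eE normE ltcR (le_lt_trans (Lu N n x))//.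
  by rewrite mulrDl; have := hN _ (leqnn N); have := hN _ Nn; lra.
pose T x : H := lim (L n x @[n --> \oo])%classic.
have TL x : (L n x @[n --> \oo] --> T x)%classic by exact: cv.
have Tlin : linear T.
  move=> a x y; apply: cvg_lim => //.
  under eq_fun do rewrite linearP.
  by apply: cvgD => //; apply: cvgZr.
pose T' : {linear H -> H} := HB.pack T (GRing.isLinear.Build R[i] H H *:%R T Tlin).
exists T' => n x /=; apply/ler_addgt0Pr => e e0.
have /cvgrPdist_le/(_ (e / 2)%:C) := TL x.
have e2 : 0 < e / 2 by rewrite divr_gt0.
rewrite -[0]/(0%:C) ltcR => /(_ e2)[N1 _ hN1].
have [N2 hN2] := small x (e / 2) e2.
pose m := maxn N1 N2.
have := hN1 m (leq_maxl _ _); rewrite /= norm_le_real => Tm.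
have := hN2 m (leq_maxr _ _) => um.
have -> : T x - L n x = (T x - L m x) + (L m x - L n x) by rewrite addrA subrK.
rewrite (le_trans (rnormD _ _))//.
by have := Lu m n x; rewrite mulrDl /=; lra.
Qed.

Variable dot : {dot H for @Num.conj R[i]}.
Hypothesis dotE : hilbert_norm dot.
Variables (A : {linear H -> H}) (M : R).
Hypotheses (Asa : selfadjoint dot A) (M0 : 0 < M) (AM : opbound A M).

Let Ab : bounded_op A. Proof. exact: opbound_bounded_op (ltW M0) AM. Qed.

(** For |t| > M the Neumann series inverts A - t. The lower bound |(A - t) x| >= (|t| - M) |x| makes
    the partial sums Cauchy and A - t injective, so the right inverse is also a left one. *)
Lemma spectrum_le (t : R) : spectrum A t%:C -> `|t| <= M.
Proof.
move=> ts; rewrite leNgt; apply/negP => tM; apply: ts.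
have t0 : t != 0 by rewrite -normr_gt0 (lt_trans M0).
have tM0 : 0 < `|t| - M by rewrite subr_gt0.
have tc0 : t%:C != 0 :> R[i] by rewrite -[0]/(0%:C) (inj_eq (@complexI R)).
have below x : (`|t| - M) * rnorm x <= rnorm (A x - t%:C *: x).
  have : rnorm (t%:C *: x) <= rnorm (A x - t%:C *: x) + rnorm (A x).
    by rewrite rnorm_distC; have := rnormD (t%:C *: x - A x) (A x); rewrite subrK.
  by rewrite rnormZ rnorm_real mulrBl; have := AM x; lra.
pose z : {poly R[i]} := t^-1%:C *: 'X.
(* Partial sums of the Neumann series, as polynomials in A, so that [resid] is the geometric sum
   identity. *)
pose p n : {poly R[i]} := - (t^-1%:C *: (\sum_(i < n) z ^+ i)).
pose L n : {linear H -> H} := poly_op (p n) A.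
pose r := M / `|t|.
have r0 : 0 <= r by rewrite divr_ge0 ?(ltW M0).
have r1 : `|r| < 1 by rewrite ger0_norm// ltr_pdivrMr ?mul1r// (lt_trans M0).
have zr n : opbound (poly_op (z ^+ n) A) (r ^+ n).
  elim: n => [|n IH] x; first by rewrite expr0 poly_opC scale1r mul1r.
  rewrite !exprS poly_opM poly_opZ poly_opX rnormZ rnorm_real normfV.
  rewrite (le_trans (ler_wpM2l _ (AM _)))// mulrA [_^-1 * _]mulrC -/r -mulrA.
  by rewrite ler_wpM2l.
have resid n x : A (L n x) - t%:C *: L n x = x - poly_op (z ^+ n) A x.
  rewrite -(poly_opX A) -(poly_opC _ A) -poly_opB /L /= -poly_opM.
  rewrite -[in X in _ = X - _](scale1r x) -(poly_opC 1 A) -poly_opB.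
  congr poly_op; have -> : 'X - t%:C%:P = t%:C *: (z - 1).
    by rewrite scalerBr scalerA -realcM mulfV// scale1r alg_polyC.
  rewrite /p mulrN -scalerAl -scalerAr scalerA -realcM mulfV// scale1r.
  by rewrite -subrX1 opprB.
pose u n : R := (`|t| - M)^-1 * r ^+ n.
have u0 : (u @ \oo --> (0 : R))%classic.
  rewrite -(mulr0 (`|t| - M)^-1); apply: cvgMr; exact: cvg_expr.
have Lu m n : opbound (L m \- L n) (u m + u n).
  move=> x; rewrite /u -mulrDr -mulrA -ler_pdivrMl ?invr_gt0// invrK.
  rewrite (le_trans (below _))//=.
  have -> : A (L m x - L n x) - t%:C *: (L m x - L n x) =
      poly_op (z ^+ n) A x - poly_op (z ^+ m) A x.
    rewrite linearB/= scalerBr opprD opprK addrACA resid.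
    rewrite [- A _ + _]addrC -[_ - A _]opprB resid.
    by rewrite opprB addrC addrA subrK.
  by rewrite (le_trans (rnormB _ _))// mulrDl addrC lerD// zr.
have [S SL] := op_limit u0 Lu.
have r_cvg : (r ^+ n @[n --> \oo] --> (0 : R))%classic by exact: cvg_expr.
have AS x : A (S x) - t%:C *: S x = x.
  apply/eqP; rewrite -subr_eq0; apply/eqP; move: x; apply: opbound_small => e e0.
  have v0 : ((M + `|t|) * u n + r ^+ n @[n --> \oo] --> (0 : R))%classic.
    rewrite (_ : 0 = (M + `|t|) * 0 + 0); last by rewrite mulr0 addr0.
    by apply: cvgD => //; exact: cvgMr.
  have /cvgrPdist_le/(_ _ e0)[n _ /(_ n (leqnn n))] := v0.
  rewrite /= sub0r normrN => /(le_trans (ler_norm _)) vn; apply: opbound_le vn _.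
  have -> : (fun x => A (S x) - t%:C *: S x - x) =
      ((A \o (S \- L n)) \- (t%:C \*: (S \- L n))) \- poly_op (z ^+ n) A.
    apply/funext => x /=; rewrite linearB/= scalerBr opprD opprK addrACA.
    have -> : - A (poly_op (p n) A x) + t%:C *: poly_op (p n) A x =
        - (x - poly_op (z ^+ n) A x) by rewrite -resid opprB addrC.
    by rewrite opprB -[RHS]addrA [_ - x - _]addrAC subrr add0r.
  rewrite mulrDl; apply: opboundB (zr n); apply: opboundB.
    exact: opbound_comp (ltW M0) AM (SL n).
  by move=> x /=; rewrite rnormZ rnorm_real -mulrA ler_wpM2l// SL.
exists S; split=> //.
  (* [L 0] is zero, so the rate [u 0] bounds [S] itself. *)
  apply: (@opbound_bounded_op _ _ _ (u 0)).
    by rewrite mulr_ge0 ?invr_ge0 ?(ltW tM0) ?exprn_ge0.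
  move=> x; have := SL 0 x.
  by rewrite /= /L /p big_ord0 scaler0 oppr0 poly_op0 subr0.
move=> x; apply/eqP; rewrite -subr_eq0 -rnorm_eq0 eq_le rnorm_ge0 andbT.
rewrite -(ler_pM2l tM0) mulr0 (le_trans (below _))//.
rewrite linearB/= scalerBr opprD opprK addrACA AS (addrC (- A x)).
by rewrite -[_ - A x]opprB subrr rnorm0.
Qed.

End FunctionalCalculus.

(** * Existence, uniqueness and algebra of the functional calculus *)

Section FunCalc.
Variables (R : realType) (H : completeNormedModType R[i]).
Variable dot : {dot H for @Num.conj R[i]}.
Hypothesis dotE : hilbert_norm dot.
Variables (A : {linear H -> H}) (M : R).
Hypotheses (Asa : selfadjoint dot A) (M0 : 0 < M) (AM : opbound A M).
Implicit Types (g h : R -> R[i]) (T S : {linear H -> H}) (p q : {poly R[i]}).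

Let Ab : bounded_op A. Proof. exact: opbound_bounded_op (ltW M0) AM. Qed.

Let sbound p c : 0 <= c ->
  (forall t : R, spectrum A t%:C -> rnorm p.[t%:C] <= c) ->
  opbound (poly_op p A) c.
Proof. exact: (poly_op_spectral_bound dotE Ab Asa). Qed.

(** The epsilon form of [is_fun_calc]: one polynomial for each tolerance replaces the sequence, and
    boundedness of [T] becomes a consequence. *)
Definition calc_approx g T := forall e : R, 0 < e -> exists p,
  (forall t : R, spectrum A t%:C -> rnorm (p.[t%:C] - g t) <= e) /\
  opbound (T \- poly_op p A) e.

Lemma is_fun_calcP g T : is_fun_calc g A T <-> calc_approx g T.
Proof.
split.
  move=> [Tb [p [up Tp]]] e e0.
  have /cvgrPdist_le/(_ e e0)[N1 _ h1] := Tp.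
  have [N2 _ h2] : (\forall n \near \oo%classic,
      forall t : R, spectrum A t%:C -> rnorm ((p n).[t%:C] - g t) <= e).
    have e0' : 0 < e%:C by rewrite -[0]/(0%:C) ltcR.
    apply: (up (fun k => forall t : R, spectrum A t%:C ->
      rnorm ((k t : R[i]) - g t) <= e)).
    apply/uniform_nbhs; exists [set xy | ball xy.1 e%:C xy.2]%classic; split.
      exact: (entourage_ball _ (PosNum e0')).
    move=> k hk t ts; have := hk t ts; rewrite -ball_normE/= => /ltW.
    by rewrite norm_le_real rnorm_distC.
  set N := maxn N1 N2; exists (p N); split; first exact/h2/leq_maxr.
  have := h1 N (leq_maxl _ _); rewrite /= sub0r normrN => /(le_trans (ler_norm _)).
  move/opbound_le; apply; apply: opnormP.
    exact: linearZ_LR.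
  have [d d0 pd] := poly_op_opbound (p N) (ltW M0) AM.
  apply: (@opbound_bounded_op _ _ _ (opnorm T + d)).
    by rewrite addr_ge0// opnorm_ge0.
  by apply: opboundB => //; exact: linear_opnormP.
move=> ga; split.
  have [p [_ Tp]] := ga 1 ltr01.
  have [d d0 pd] := poly_op_opbound p (ltW M0) AM.
  apply: (@opbound_bounded_op _ _ _ (1 + d)); first by rewrite addr_ge0.
  by move=> x; have := opboundD Tp pd x; rewrite /= subrK.
have /choice[p hp] : forall n, exists p : {poly R[i]},
    (forall t : R, spectrum A t%:C -> rnorm (p.[t%:C] - g t) <= n.+1%:R^-1) /\
    opbound (T \- poly_op p A) n.+1%:R^-1.
  by move=> n; apply: ga; rewrite invr_gt0.
have small (e : R) : 0 < e -> (\forall n \near \oo%classic, n.+1%:R^-1 < e).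
  by move=> e0; exact: near_infty_natSinv_lt (PosNum e0).
exists p; split.
  move=> P /uniform_nbhs[E [entE EP]]; move: entE; rewrite -entourage_ballE.
  case=> e /= e0 eE.
  have eC : e = (complex.Re e)%:C by rewrite RRe_real// gtr0_real.
  have /small[N _ hN] : 0 < complex.Re e by rewrite -ltcR -eC.
  exists N => // n /= Nn; apply: EP => t ts; apply: eE => /=.
  rewrite -ball_normE/= eC normE ltcR rnorm_distC.
  have [pn _] := hp n; exact: le_lt_trans (pn t ts) (hN n Nn).
apply/cvgrPdist_le => e /small[N _ hN]; exists N => // n /= Nn.
rewrite sub0r normrN ger0_norm; last first.
  apply: opnorm_ge0; have [_ pn] := hp n.
  by apply: opbound_bounded_op pn; rewrite invr_ge0.
apply: le_trans (ltW (hN n Nn)); apply: opbound_opnorm_le => //.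
by have [] := hp n.
Qed.

Lemma calc_approx_dist g T p c : calc_approx g T -> 0 <= c ->
  (forall t : R, spectrum A t%:C -> rnorm (g t - p.[t%:C]) <= c) ->
  opbound (T \- poly_op p A) c.
Proof.
move=> gT c0 gp; apply: opbound_approx => e e0.
have [q [qg Tq]] := gT (e / 2) ltac:(by rewrite divr_gt0).
have qp : opbound (poly_op (q - p) A) (e / 2 + c).
  apply: sbound => [|t ts]; first by rewrite addr_ge0// divr_ge0 ?(ltW e0).
  rewrite hornerD hornerN -[X in rnorm X](subrKA (g t)).
  by rewrite (le_trans (rnormD _ _))// lerD ?gp ?qg.
move=> x; have := opboundD Tq qp x; rewrite /= poly_opB subrKA.
by have -> : e / 2 + (e / 2 + c) = c + e by lra.
Qed.

Lemma calc_approx_bound g T c : calc_approx g T -> 0 <= c ->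
  (forall t : R, spectrum A t%:C -> rnorm (g t) <= c) -> opbound T c.
Proof.
move=> gT c0 gc x.
have := @calc_approx_dist g T 0 c gT c0 _ x; rewrite /= poly_op0 subr0; apply.
by move=> t ts; rewrite horner0 subr0 gc.
Qed.

Lemma calc_approx_poly p g : (forall t : R, p.[t%:C] = g t) ->
  calc_approx g (poly_op p A).
Proof.
move=> pg e e0; exists p; split=> [t _|x /=]; first by rewrite pg subrr rnorm0 ltW.
by rewrite subrr rnorm0 mulr_ge0 ?rnorm_ge0 ?(ltW e0).
Qed.

Lemma calc_approxD g h T S : calc_approx g T -> calc_approx h S ->
  calc_approx (fun t => g t + h t) (T \+ S).
Proof.
move=> gT hS e e0; have e2 : 0 < e / 2 by rewrite divr_gt0.
have [p [pg Tp]] := gT _ e2; have [q [qh Sq]] := hS _ e2.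
exists (p + q); split=> [t ts|x /=].
  rewrite hornerD opprD addrACA (le_trans (rnormD _ _))//.
  by have := pg t ts; have := qh t ts; lra.
rewrite poly_opD opprD addrACA (le_trans (rnormD _ _))//.
by have := Tp x; have := Sq x; rewrite /=; lra.
Qed.

Lemma calc_approxN g T : calc_approx g T -> calc_approx (fun t => - g t) (\- T).
Proof.
move=> gT e e0; have [p [pg Tp]] := gT _ e0.
exists (- p); split=> [t ts|x /=].
  by rewrite hornerN -opprD rnormN pg.
rewrite -[- p]sub0r poly_opB poly_op0 sub0r -opprD rnormN.
exact: Tp.
Qed.

Lemma calc_approx_uniq g T S : calc_approx g T -> calc_approx g S -> T =1 S.
Proof.
move=> gT gS x; apply/eqP; rewrite -subr_eq0; apply/eqP; move: x.
apply: opbound0.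
apply: (@calc_approx_bound _ _ _ (calc_approxD gT (calc_approxN gS))) => //.
by move=> t _; rewrite subrr rnorm0.
Qed.

Lemma calc_approxM g h T S c : 0 <= c ->
  (forall t : R, spectrum A t%:C -> rnorm (g t) <= c) ->
  (forall t : R, spectrum A t%:C -> rnorm (h t) <= c) ->
  calc_approx g T -> calc_approx h S ->
  calc_approx (fun t => g t * h t) (T \o S).
Proof.
move=> c0 gc hc gT hS e e0.
have Tc := calc_approx_bound gT c0 gc.
(* Chosen so that c d + d (c + d) <= e: as d <= 1, the left side is at most d (2 c + 1). *)
pose d := Num.min 1 (e / (2 * c + 1)).
have c1 : 0 < 2 * c + 1 by rewrite ltr_wpDl ?mulr_ge0.
have d0 : 0 < d by rewrite lt_min ltr01 divr_gt0.
have de : c * d + d * (c + d) <= e.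
  have d1 : d <= 1 by rewrite ge_min lexx.
  have : d * (2 * c + 1) <= e by rewrite -ler_pdivlMr// ge_min lexx orbT.
  by nra.
have [p [pg Tp]] := gT _ d0; have [q [qh Sq]] := hS _ d0.
have qc t : spectrum A t%:C -> rnorm q.[t%:C] <= c + d.
  move=> ts; rewrite -[X in rnorm X](subrK (h t)) addrC.
  by rewrite (le_trans (rnormD _ _))// lerD ?hc ?qh.
have cd0 : 0 <= c + d by rewrite addr_ge0 ?(ltW d0).
have Qc := sbound cd0 qc.
exists (p * q); split=> [t ts|].
  rewrite hornerM.
  have -> : p.[t%:C] * q.[t%:C] - g t * h t =
    g t * (q.[t%:C] - h t) + (p.[t%:C] - g t) * q.[t%:C] by ring.
  rewrite (le_trans (rnormD _ _))// !rnormM (le_trans _ de)// lerD//.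
    by rewrite ler_pM ?rnorm_ge0 ?gc ?qh.
  by rewrite ler_pM ?rnorm_ge0 ?qc ?pg.
apply: opbound_le de _.
move=> x; have := opboundD (opbound_comp c0 Tc Sq)
  (opbound_comp (ltW d0) Tp Qc) x.
by rewrite /= linearB/= subrKA poly_opM.
Qed.

Lemma calc_approx_adjoint g T S :
  calc_approx g T -> calc_approx (fun t => Num.conj (g t)) S ->
  forall x y, dot (T x) y = dot x (S y).
Proof.
move=> gT gS x y; apply/eqP; rewrite -subr_eq0 -rnorm_eq0 eq_le rnorm_ge0 andbT.
apply/ler_addgt0Pr => e e0; rewrite add0r.
pose K := 2 * (rnorm x * rnorm y) + 1.
have K0 : 0 < K by rewrite ltr_wpDl ?mulr_ge0 ?rnorm_ge0.
have d0 : 0 < e / K by rewrite divr_gt0.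
have [p [pg Tp]] := gT _ d0.
have Sp : opbound (S \- poly_op (map_poly Num.conj p) A) (e / K).
  apply: (calc_approx_dist gS (ltW d0)).
  move=> t ts; rewrite horner_conj_real -rmorphB rnormJ rnorm_distC; exact: pg.
have -> : dot (T x) y - dot x (S y) =
    dot ((T \- poly_op p A) x) y
    - dot x ((S \- poly_op (map_poly Num.conj p) A) y).
  by rewrite /= dotBl dotBr (dot_poly_op Asa) opprB addrA subrK.
rewrite (le_trans (rnormB _ _))//.
have h1 : rnorm (dot ((T \- poly_op p A) x) y) <= e / K * rnorm x * rnorm y.
  by rewrite (le_trans (cauchy_schwarz dotE _ _))// ler_wpM2r ?rnorm_ge0.
have h2 : rnorm (dot x ((S \- poly_op (map_poly Num.conj p) A) y)) <=
    rnorm x * (e / K * rnorm y).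
  by rewrite (le_trans (cauchy_schwarz dotE _ _))// ler_wpM2l ?rnorm_ge0.
rewrite (le_trans (lerD h1 h2))//.
rewrite -[leRHS](@mulfVK _ K) ?gt_eqF//; move: (e / K) d0 => d d0.
by rewrite /K; nra.
Qed.

(** Weierstrass polynomials on [[-M, M]], which contains the real points of the spectrum, are Cauchy
    in operator norm by the spectral bound. *)
Lemma calc_approx_ex g : ucontb M g -> exists T, calc_approx g T.
Proof.
move=> gu.
have /choice[p hp] : forall n, exists p : {poly R[i]},
    forall x : R, `|x| <= M -> rnorm (p.[x%:C] - g x) <= n.+1%:R^-1.
  by move=> n; apply: weierstrass gu _ => //; rewrite invr_gt0.
pose u n : R := n.+1%:R^-1.
have small (e : R) : 0 < e -> (\forall n \near \oo%classic, u n < e).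
  by move=> e0; exact: near_infty_natSinv_lt (PosNum e0).
have u0 : (u @ \oo --> (0 : R))%classic.
  apply/cvgrPdist_lt => e /small[N _ hN]; exists N => // n /= Nn.
  by rewrite sub0r normrN ger0_norm ?invr_ge0// hN.
have Lu m n : opbound (poly_op (p m) A \- poly_op (p n) A) (u m + u n).
  move=> x; rewrite /= -poly_opB; move: x; apply: sbound.
    by rewrite addr_ge0// invr_ge0.
  move=> t /(spectrum_le M0 AM) tM.
  rewrite hornerD hornerN -[X in rnorm X](subrKA (g t)).
  by rewrite (le_trans (rnormD _ _))// lerD ?hp// rnorm_distC hp.
have [T TL] := op_limit u0 Lu.
exists T => e /small[n _ /(_ n (leqnn n)) ne]; exists (p n); split=> [t ts|].
  by rewrite (le_trans (hp n t _)) ?(ltW ne)//; exact: (spectrum_le M0 AM).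
exact: opbound_le (ltW ne) (TL n).
Qed.

(** Existence rules out the default value in [fun_calc]; with uniqueness, an identity for [fun_calc]
    can be proved by exhibiting approximating polynomials. *)
Lemma fun_calc_approx g : ucontb M g -> calc_approx g (fun_calc g A).
Proof.
move=> gu; apply/is_fun_calcP; rewrite /fun_calc; case: xgetP => //= nT.
have [T /is_fun_calcP gT] := calc_approx_ex gu.
by have := nT T gT.
Qed.

Lemma fun_calcE g T : ucontb M g -> calc_approx g T -> fun_calc g A =1 T.
Proof. by move=> gu; apply: calc_approx_uniq; exact: fun_calc_approx. Qed.

End FunCalc.

(** * Closure properties of uniform continuity *)

Section Ucontb.
Variables (R : realType) (M : R).
Hypothesis M0 : 0 < M.
Implicit Types g h : R -> R[i].

Lemma ucontb_eq g h : g =1 h -> ucontb M g -> ucontb M h.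
Proof. by move=> /funext ->. Qed.

Lemma ucontb_cst c : ucontb M (fun _ => c).
Proof.
split; first by exists (rnorm c).
by move=> e e0; exists 1 => // x y _ _ _; rewrite subrr rnorm0 ltW.
Qed.

Lemma ucontb_id : ucontb M (fun t => t%:C).
Proof.
split; first by exists M => x; rewrite rnorm_real.
by move=> e e0; exists e => // x y _ _; rewrite -realcB rnorm_real.
Qed.

Lemma ucontbD g h : ucontb M g -> ucontb M h -> ucontb M (fun t => g t + h t).
Proof.
move=> [[c gc] gu] [[d hd] hu]; split.
  exists (c + d) => x xM; rewrite (le_trans (rnormD _ _))//.
  by rewrite lerD ?gc ?hd.
move=> e e0; have e2 : 0 < e / 2 by rewrite divr_gt0.
have [a a0 ga] := gu _ e2; have [b b0 hb] := hu _ e2.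
exists (Num.min a b); first by rewrite lt_min a0.
move=> x y xM yM; rewrite le_min => /andP[xa xb].
rewrite opprD addrACA (le_trans (rnormD _ _))//.
by have := ga x y xM yM xa; have := hb x y xM yM xb; lra.
Qed.

Lemma ucontbM g h : ucontb M g -> ucontb M h -> ucontb M (fun t => g t * h t).
Proof.
move=> [[c gc] gu] [[d hd] hu].
have c0 : 0 <= c by rewrite (le_trans (rnorm_ge0 (g 0)))// gc// normr0 ltW.
have d0 : 0 <= d by rewrite (le_trans (rnorm_ge0 (h 0)))// hd// normr0 ltW.
split; first by exists (c * d) => x xM; rewrite rnormM ler_pM ?rnorm_ge0 ?gc ?hd.
move=> e e0; pose k := c + d + 1; have k0 : 0 < k by rewrite /k; lra.
have ek : 0 < e / k by rewrite divr_gt0.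
have [a a0 ga] := gu _ ek; have [b b0 hb] := hu _ ek.
exists (Num.min a b); first by rewrite lt_min a0.
move=> x y xM yM; rewrite le_min => /andP[xa xb].
have -> : g x * h x - g y * h y = g x * (h x - h y) + (g x - g y) * h y by ring.
rewrite (le_trans (rnormD _ _))// !rnormM.
have h1 : rnorm (g x) * rnorm (h x - h y) <= c * (e / k).
  by rewrite ler_pM ?rnorm_ge0 ?gc ?hb.
have h2 : rnorm (g x - g y) * rnorm (h y) <= e / k * d.
  by rewrite ler_pM ?rnorm_ge0 ?hd ?ga.
rewrite (le_trans (lerD h1 h2))// -[leRHS](@mulfVK _ k) ?gt_eqF//.
by rewrite /k in ek *; nra.
Qed.

Lemma ucontbN g : ucontb M g -> ucontb M (fun t => - g t).
Proof.
move=> gu; apply: (ucontb_eq _ (ucontbM (ucontb_cst (-1)) gu)) => t.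
by rewrite mulN1r.
Qed.

Lemma ucontbB g h : ucontb M g -> ucontb M h -> ucontb M (fun t => g t - h t).
Proof. by move=> gu hu; apply: ucontbD => //; exact: ucontbN. Qed.

Lemma ucontb_sum (I : finType) (P : pred I) (g : I -> R -> R[i]) :
  (forall i, ucontb M (g i)) -> ucontb M (fun t => \sum_(i | P i) g i t).
Proof.
move=> gu; rewrite -fct_sumE; elim/big_rec: _ => [|i h _ hu].
  exact: ucontb_cst.
exact: ucontbD.
Qed.

Lemma ucontb_conj g : ucontb M g -> ucontb M (fun t => Num.conj (g t)).
Proof.
move=> [[c gc] gu]; split; first by exists c => x xM; rewrite rnormJ gc.
move=> e e0; have [d d0 gd] := gu e e0; exists d => // x y xM yM xy.
by rewrite -rmorphB rnormJ gd.
Qed.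

(** Subadditivity of the square root, by squaring. It gives the continuity of the square roots of
    hats and of the defect in [fun_calc_sumsq]. *)
Lemma sqrtr_dist (a b : R) : `|Num.sqrt a - Num.sqrt b| <= Num.sqrt `|a - b|.
Proof.
wlog ab : a b / a <= b.
  move=> hw; have [/hw//|/ltW/hw] := leP a b.
  by rewrite distrC [`|b - a|]distrC.
rewrite distrC [`|a - b|]distrC !ger0_norm ?subr_ge0 ?ler_wsqrtr//.
have [b0|b0] := leP b 0.
  by rewrite (ler0_sqrtr b0) sub0r (le_trans _ (sqrtr_ge0 _))// oppr_le0 sqrtr_ge0.
have s0 : 0 <= Num.sqrt a + Num.sqrt (b - a) by rewrite addr_ge0 ?sqrtr_ge0.
rewrite lerBlDl -(@ler_pXn2r _ 2) ?nnegrE ?sqrtr_ge0// sqr_sqrtr ?(ltW b0)//.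
rewrite sqrrD [Num.sqrt (b - a) ^+ 2]sqr_sqrtr ?subr_ge0//.
have : 0 <= Num.sqrt a * Num.sqrt (b - a) by rewrite mulr_ge0 ?sqrtr_ge0.
have [a0|a0] := leP a 0; first by rewrite (ler0_sqrtr a0); nra.
by rewrite sqr_sqrtr ?(ltW a0)//; nra.
Qed.

Lemma ucontb_sqrt (w : R -> R) :
  ucontb M (fun t => (w t)%:C) -> ucontb M (fun t => (Num.sqrt (w t))%:C).
Proof.
move=> [[c wc] wu]; split.
  exists (Num.sqrt c) => x xM; rewrite rnorm_real ger0_norm ?sqrtr_ge0//.
  by rewrite ler_wsqrtr// (le_trans (ler_norm _))// -rnorm_real wc.
move=> e e0; have [d d0 wd] := wu (e ^+ 2) ltac:(by rewrite exprn_gt0).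
exists d => // x y xM yM xy; rewrite -realcB rnorm_real.
have eE : Num.sqrt (e ^+ 2) = e by rewrite sqrtr_sqr ger0_norm ?(ltW e0).
rewrite (le_trans (sqrtr_dist _ _))// -[leRHS]eE ler_wsqrtr// -rnorm_real.
by rewrite realcB wd.
Qed.

Lemma ucontb_lipschitz (w : R -> R) k : 0 <= k ->
  (forall x y, `|w x - w y| <= k * `|x - y|) -> ucontb M (fun t => (w t)%:C).
Proof.
move=> k0 wk; split.
  exists (k * M + `|w 0|) => x xM; rewrite rnorm_real.
  rewrite -[w x](subrK (w 0)) (le_trans (ler_normD _ _))// lerD2r.
  by rewrite (le_trans (wk _ _))// subr0 ler_wpM2l.
move=> e e0; have k1 : 0 < k + 1 by rewrite ltr_wpDl.
exists (e / (k + 1)); first by rewrite divr_gt0.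
move=> x y _ _ xy; rewrite -realcB rnorm_real (le_trans (wk _ _))//.
rewrite (le_trans (ler_wpM2l k0 xy))// mulrA ler_pdivrMr// mulrC.
rewrite ler_wpM2l ?(ltW e0)//.
by rewrite lerDl.
Qed.

End Ucontb.

(** * Rules of the functional calculus *)

Section CalculusRules.
Variables (R : realType) (H : completeNormedModType R[i]).
Variable dot : {dot H for @Num.conj R[i]}.
Hypothesis dotE : hilbert_norm dot.
Variables (A : {linear H -> H}) (M : R).
Hypotheses (Asa : selfadjoint dot A) (M0 : 0 < M) (AM : opbound A M).
Implicit Types (g h : R -> R[i]) (x y : H).

Let calcE g T : ucontb M g -> calc_approx A g T -> fun_calc g A =1 T.
Proof. exact: (fun_calcE dotE Asa M0 AM). Qed.

Let calcP g : ucontb M g -> calc_approx A g (fun_calc g A).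
Proof. exact: (fun_calc_approx dotE Asa M0 AM). Qed.

Lemma fun_calc_eq g h : ucontb M g -> ucontb M h ->
  (forall t : R, `|t| <= M -> g t = h t) -> fun_calc g A =1 fun_calc h A.
Proof.
move=> gu hu gh; apply: calcE => // e e0; have [p [ph hp]] := calcP hu e0.
by exists p; split=> // t ts; rewrite gh ?ph//; exact: (spectrum_le M0 AM).
Qed.

Lemma fun_calcM g h : ucontb M g -> ucontb M h ->
  forall x, fun_calc (fun t => g t * h t) A x = fun_calc g A (fun_calc h A x).
Proof.
move=> gu hu x.
have [[c gc] _] := gu; have [[d hd] _] := hu.
have c0 : 0 <= c by rewrite (le_trans (rnorm_ge0 (g 0)))// gc// normr0 ltW.
apply: (@calcE _ (fun_calc g A \o fun_calc h A)); first exact: ucontbM.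
apply: (calc_approxM dotE Asa M0 AM (c := Num.max c d)) => //.
- by rewrite le_max c0.
- by move=> t /(spectrum_le M0 AM)/gc tc; rewrite le_max tc.
- by move=> t /(spectrum_le M0 AM)/hd td; rewrite le_max td orbT.
- exact: calcP.
- exact: calcP.
Qed.

Lemma fun_calc_comm g h : ucontb M g -> ucontb M h ->
  forall x, fun_calc g A (fun_calc h A x) = fun_calc h A (fun_calc g A x).
Proof.
move=> gu hu x; rewrite -!fun_calcM//; congr (fun_calc _ A x).
by apply/funext => t; rewrite mulrC.
Qed.

Lemma fun_calcD g h : ucontb M g -> ucontb M h ->
  forall x, fun_calc (fun t => g t + h t) A x = fun_calc g A x + fun_calc h A x.
Proof.
move=> gu hu x; apply: (@calcE _ (fun_calc g A \+ fun_calc h A)).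
  exact: ucontbD.
by apply: calc_approxD; exact: calcP.
Qed.

Lemma fun_calc_cst c x : fun_calc (fun _ => c) A x = c *: x.
Proof.
have cp : calc_approx A (fun _ => c) (poly_op c%:P A).
  by apply: calc_approx_poly => t; rewrite hornerC.
rewrite (calcE (ucontb_cst M c) cp); exact: poly_opC.
Qed.

Lemma fun_calc_id x : fun_calc (fun t => t%:C) A x = A x.
Proof.
have Xp : calc_approx A (fun t => t%:C) (poly_op 'X A).
  by apply: calc_approx_poly => t; rewrite hornerX.
rewrite (calcE (ucontb_id M) Xp); exact: poly_opX.
Qed.

Lemma fun_calcZ c g : ucontb M g ->
  forall x, fun_calc (fun t => c * g t) A x = c *: fun_calc g A x.
Proof. by move=> gu x; rewrite fun_calcM ?fun_calc_cst//; exact: ucontb_cst. Qed.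

Lemma fun_calc_sum (I : finType) (P : pred I) (g : I -> R -> R[i]) :
  (forall i, ucontb M (g i)) -> forall x,
  fun_calc (fun t => \sum_(i | P i) g i t) A x = \sum_(i | P i) fun_calc (g i) A x.
Proof.
move=> gu x; rewrite -fct_sumE.
have : ucontb M (\sum_(i | P i) g i) /\
    fun_calc (\sum_(i | P i) g i) A x = \sum_(i | P i) fun_calc (g i) A x.
  elim/big_rec2: _ => [|i y h _ [hu IH]].
    by split; [exact: ucontb_cst|rewrite fun_calc_cst scale0r].
  by split; [exact: ucontbD|rewrite fun_calcD// IH].
by case.
Qed.

Lemma dot_fun_calc g : ucontb M g -> forall x y,
  dot (fun_calc g A x) y = dot x (fun_calc (fun t => Num.conj (g t)) A y).
Proof.
move=> gu; apply: (calc_approx_adjoint dotE Asa M0 AM (g := g)); first exact: calcP.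
exact/calcP/ucontb_conj.
Qed.

Lemma rnorm_fun_calc g x : ucontb M g ->
  (rnorm (fun_calc g A x) ^+ 2)%:C =
  dot x (fun_calc (fun t => (rnorm (g t) ^+ 2)%:C) A x).
Proof.
move=> gu; rewrite -(dot_rnorm dotE) dot_fun_calc// -fun_calcM//; last exact: ucontb_conj.
by congr (dot x (fun_calc _ A x)); apply/funext => t; rewrite mulrC rnormK.
Qed.

(* The defect [c^2 - sum |g_i|^2] is the square of a real function, so it acts
   as a positive operator. *)
Lemma fun_calc_sumsq (I : finType) (g : I -> R -> R[i]) (c : R) :
  (forall i, ucontb M (g i)) ->
  (forall t : R, `|t| <= M -> \sum_i rnorm (g i t) ^+ 2 <= c ^+ 2) ->
  forall x, \sum_i rnorm (fun_calc (g i) A x) ^+ 2 <= c ^+ 2 * rnorm x ^+ 2.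
Proof.
move=> gu gc x; pose w t := c ^+ 2 - \sum_i rnorm (g i t) ^+ 2.
have wE t : (w t)%:C = (c ^+ 2)%:C - \sum_i g i t * Num.conj (g i t).
  by rewrite realcB rmorph_sum; congr (_ - _); apply: eq_bigr => i _; rewrite rnormK.
have gsu i : ucontb M (fun t => (rnorm (g i t) ^+ 2)%:C).
  apply: (ucontb_eq _ (ucontbM M0 (gu i) (ucontb_conj (gu i)))) => t.
  by rewrite rnormK.
have wu : ucontb M (fun t => (w t)%:C).
  apply: (ucontb_eq (fun t => esym (wE t))); apply: (ucontbB M0).
    exact: ucontb_cst.
  by apply: ucontb_sum => i; apply: (ucontbM M0) => //; exact: ucontb_conj.
(* Outside [[-M, M]] the defect [w] may be negative and [Num.sqrt] then returns 0; [fun_calc_eq]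
   compares functions on [[-M, M]] only. *)
have Gu := ucontb_sqrt wu; set G := fun t => _ in Gu.
have Gsu : ucontb M (fun t => (rnorm (G t) ^+ 2)%:C).
  apply: (ucontb_eq _ (ucontbM M0 Gu (ucontb_conj Gu))) => t.
  by rewrite rnormK.
have : rnorm (fun_calc G A x) ^+ 2 + \sum_i rnorm (fun_calc (g i) A x) ^+ 2 =
    c ^+ 2 * rnorm x ^+ 2.
  apply: (@complexI R); rewrite realcD rmorph_sum/=.
  under eq_bigr do rewrite rnorm_fun_calc//.
  rewrite rnorm_fun_calc// -dot_sumr -(dotDr dot) -fun_calc_sum//.
  rewrite -fun_calcD//; last exact: ucontb_sum.
  rewrite (_ : fun_calc _ A x = (c ^+ 2)%:C *: x); last first.
    rewrite -fun_calc_cst; apply: fun_calc_eq => [||t tM].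
    - by apply: ucontbD => //; exact: ucontb_sum.
    - exact: ucontb_cst.
    - rewrite -rmorph_sum -realcD; congr (_%:C); rewrite rnorm_real.
      by rewrite real_normK ?num_real// sqr_sqrtr ?subr_ge0 ?gc// subrK.
  rewrite dotZr (dot_rnorm dotE) [in RHS]realcM.
  by have -> : Num.conj (c ^+ 2)%:C = (c ^+ 2)%:C :> R[i] by exact: conjc_real.
by move=> <-; rewrite lerDr sqr_ge0.
Qed.

Lemma fun_calc_opbound g (c : R) : 0 <= c -> ucontb M g ->
  (forall t : R, `|t| <= M -> rnorm (g t) <= c) -> opbound (fun_calc g A) c.
Proof.
move=> c0 gu gc.
apply: (calc_approx_bound dotE Asa M0 AM (calcP gu) c0) => t ts.
by apply: gc; exact: (spectrum_le M0 AM).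
Qed.

Lemma fun_calc_eq0 g : ucontb M g -> (forall t : R, `|t| <= M -> g t = 0) ->
  forall x, fun_calc g A x = 0.
Proof.
move=> gu g0; apply: opbound0; apply: fun_calc_opbound => // t tM.
by rewrite g0// rnorm0.
Qed.

End CalculusRules.

(** * Hat functions and the Schur test *)

Section Hat.
Variable R : realType.
Implicit Types (u : R) (n D i j : nat).

Definition hat u : R := Num.max 0 (1 - `|u|).

Lemma hat_ge0 u : 0 <= hat u.
Proof. by rewrite /hat le_max lexx. Qed.

Lemma hat_le1 u : hat u <= 1.
Proof. by rewrite /hat ge_max ler01 gerBl normr_ge0. Qed.

Lemma hat_out u : 1 <= `|u| -> hat u = 0.
Proof. by move=> u1; apply: max_idPl; rewrite subr_le0. Qed.

Lemma hat_in u : `|u| <= 1 -> hat u = 1 - `|u|.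
Proof. by move=> u1; apply: max_idPr; rewrite subr_ge0. Qed.

Lemma hat_lipschitz u v : `|hat u - hat v| <= `|u - v|.
Proof.
have uv := ler_dist_dist u v; move: uv; rewrite ler_norml => /andP[uv1 uv2].
rewrite ler_norml /hat /Num.max.
by case: ifPn => h1; case: ifPn => h2; rewrite -?leNgt in h1 h2; apply/andP; split; lra.
Qed.

(** Induction on [n]: for u <= n the last hat vanishes; for n < u <= n + 1 only the last two
    survive, and they add up to 1. *)
Lemma hat_sum n u : 0 <= u <= n%:R -> \sum_(i < n.+1) hat (u - i%:R) = 1.
Proof.
move=> /andP[u0]; elim: n => [|n IH] un.
  by rewrite big_ord1 subr0 hat_in ger0_norm//; lra.
rewrite big_ord_recr/=; have [{}un'|{}un'] := leP u n%:R.
  rewrite IH// hat_out ?addr0// ler0_norm -natr1; lra.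
rewrite big_ord_recr/= big1; last first.
  move=> i _; apply: hat_out.
  have : i.+1%:R <= n%:R :> R by rewrite ler_nat.
  by rewrite -natr1 => h; rewrite ger0_norm; lra.
move: un; rewrite -natr1 => un.
by rewrite !hat_in ?ler_norml; [rewrite ger0_norm ?ler0_norm; lra|lra|lra].
Qed.

(** |i - j| <= D, written with additions to avoid truncated subtraction. *)
Definition near_idx D i j := ((i <= j + D) && (j <= i + D))%N.

Lemma near_idxE D i j : near_idx D i j = (`|i%:R - j%:R : R| <= D%:R).
Proof.
by rewrite ler_distlC lerBlDr -!natrD !ler_nat /near_idx; lia.
Qed.

Lemma far_idx D i j : ~~ near_idx D i j -> D.+1%:R <= `|i%:R - j%:R : R|.
Proof.
rewrite /near_idx negb_and -!ltnNge => /orP[h|h].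
  rewrite -(ler_nat R) -addnS natrD in h.
  by rewrite (le_trans _ (ler_norm _))// lerBrDl.
rewrite -(ler_nat R) -addnS natrD in h.
by rewrite distrC (le_trans _ (ler_norm _))// lerBrDl.
Qed.

Lemma near_idx_sym D i j : near_idx D i j = near_idx D j i.
Proof. by rewrite /near_idx andbC. Qed.

Lemma near_idx_card D m (S : pred 'I_m) i :
  (forall j : 'I_m, S j -> near_idx D i j) -> (#|S| <= D.*2.+1)%N.
Proof.
move=> Sn; rewrite cardE -(size_map (@nat_of_ord m)) -(size_iota (i - D) D.*2.+1).
apply: uniq_leq_size; first by rewrite map_inj_uniq ?enum_uniq//; exact: ord_inj.
move=> _ /mapP[j jS ->]; move: jS; rewrite mem_enum => /Sn.
move=> /andP[h1 h2].
by rewrite mem_iota -addnn; apply/andP; split; lia.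
Qed.

End Hat.

(** * Schur test for band sums *)

Section BandSum.
Variables (R : realType) (H : completeNormedModType R[i]).
Variable dot : {dot H for @Num.conj R[i]}.
Hypothesis dotE : hilbert_norm dot.

(* Schur test: pair the sum with itself and split each term by AM-GM; the
   weights are chosen so that the second half is absorbed by the left side. *)
Lemma schur_test (I : finType) (S : rel I) (N : nat) (a b : R) (w : R)
    (La La' Lb : I -> H -> H) (W : I -> I -> H -> H) :
  (0 < N)%N -> 0 < a -> 0 <= b -> 0 <= w ->
  (forall i, #|[pred j | S i j]| <= N)%N ->
  (forall j, #|[pred i | S i j]| <= N)%N ->
  (forall i x y, dot (La i x) y = dot x (La' i y)) ->
  (forall y, \sum_i rnorm (La' i y) ^+ 2 <= a ^+ 2 * rnorm y ^+ 2) ->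
  (forall x, \sum_j rnorm (Lb j x) ^+ 2 <= b ^+ 2 * rnorm x ^+ 2) ->
  (forall i j, S i j -> opbound (W i j) w) ->
  opbound (fun x => \sum_i \sum_(j | S i j) La i (W i j (Lb j x)))
    (N%:R * w * a * b).
Proof.
move=> N0 a0 b0 w0 Srow Scol Laa La2 Lb2 Ww x; set z := (X in rnorm X).
have NR0 : 0 < N%:R :> R by rewrite ltr0n.
have Na : 0 < N%:R * a ^+ 2 by rewrite mulr_gt0// exprn_gt0.
have z2 : 2 * rnorm z ^+ 2 <= \sum_i \sum_(j | S i j)
    (N%:R * a ^+ 2 * w ^+ 2 * rnorm (Lb j x) ^+ 2
     + rnorm (La' i z) ^+ 2 / (N%:R * a ^+ 2)).
  have -> : rnorm z ^+ 2 = rnorm (dot z z).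
    by rewrite (dot_rnorm dotE) rnorm_real ger0_norm ?sqr_ge0.
  rewrite {1}/z dot_suml -ler_pdivlMl// mulr_sumr.
  rewrite (le_trans (rnorm_sum _ _))// ler_sum// => i _.
  rewrite dot_suml mulr_sumr (le_trans (rnorm_sum _ _))// ler_sum// => j Sij.
  rewrite Laa (le_trans (cauchy_schwarz dotE _ _))//.
  have := Ww i j Sij (Lb j x); set u := rnorm (Lb j x); set v := rnorm (La' i z).
  set k := N%:R * a ^+ 2 in Na *; set t := rnorm _ => tw.
  have v0 : 0 <= v by exact: rnorm_ge0.
  have : 0 <= (k * w * u - v) ^+ 2 / k by rewrite divr_ge0 ?sqr_ge0 ?(ltW Na).
  have -> : (k * w * u - v) ^+ 2 / k =
      k * w ^+ 2 * u ^+ 2 + v ^+ 2 / k - 2 * (w * u * v).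
    by field; rewrite gt_eqF.
  by have := ler_wpM2r v0 tw; lra.
(* The first halves sum to at most the squared target bound, by [Scol] and [Lb2]; the second halves
   to at most |z|^2, by [Srow] and [La2]. *)
have z3 : 2 * rnorm z ^+ 2 <= (N%:R * w * a * b * rnorm x) ^+ 2 + rnorm z ^+ 2.
  apply: (le_trans z2); under eq_bigr do rewrite big_split/=.
  rewrite big_split/= lerD//.
    rewrite (exchange_big_dep predT)//=.
    have -> : (N%:R * w * a * b * rnorm x) ^+ 2 =
        N%:R * (N%:R * a ^+ 2 * w ^+ 2) * (b ^+ 2 * rnorm x ^+ 2) by ring.
    have k0 : 0 <= N%:R * (N%:R * a ^+ 2 * w ^+ 2).
      by rewrite mulr_ge0 ?(ltW NR0)// mulr_ge0 ?sqr_ge0 ?(ltW Na).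
    apply: le_trans (ler_wpM2l k0 (Lb2 x)); rewrite mulr_sumr ler_sum// => j _.
    rewrite sumr_const -[leLHS]mulr_natl -[leRHS]mulrA.
    rewrite ler_wpM2r ?ler_nat//; last exact: Scol.
    by rewrite mulr_ge0 ?sqr_ge0// mulr_ge0 ?sqr_ge0 ?(ltW Na).
  have -> : rnorm z ^+ 2 = (a ^- 2) * (a ^+ 2 * rnorm z ^+ 2).
    by rewrite mulrA mulVf ?mul1r// gt_eqF// exprn_gt0.
  have a20 : 0 <= a ^- 2 by rewrite invr_ge0 sqr_ge0.
  apply: le_trans (ler_wpM2l a20 (La2 z)); rewrite mulr_sumr ler_sum// => i _.
  rewrite sumr_const -[leLHS]mulr_natl.
  have -> : #|[pred j | S i j]|%:R * (rnorm (La' i z) ^+ 2 / (N%:R * a ^+ 2)) =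
     (#|[pred j | S i j]|%:R / N%:R) * (a ^- 2 * rnorm (La' i z) ^+ 2).
    by field; rewrite !gt_eqF.
  rewrite ler_piMl ?(mulr_ge0 a20) ?sqr_ge0//.
  rewrite ler_pdivrMr// mul1r ler_nat; exact: Srow.
have c0 : 0 <= N%:R * w * a * b * rnorm x.
  by rewrite mulr_ge0 ?rnorm_ge0// mulr_ge0// mulr_ge0 ?(ltW a0)// mulr_ge0 ?(ltW NR0).
rewrite -(@ler_pXn2r _ 2) ?nnegrE ?rnorm_ge0//; lra.
Qed.

End BandSum.

(** * Partition of unity of mesh s on the interval [-M, M] *)

Section Lattice.
Variables (R : realType) (M s : R).
Hypothesis s0 : 0 < s.
Implicit Types (t : R) (i n : nat).

Definition node i : R := i%:R * s - M.
Definition hatf i t : R := hat ((t - node i) / s).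
Definition pf i t : R[i] := (hatf i t)%:C.
Definition qf i t : R[i] := (Num.sqrt (hatf i t))%:C.

Lemma hatf_ge0 i t : 0 <= hatf i t. Proof. exact: hat_ge0. Qed.

Lemma hatf_out i t : s <= `|t - node i| -> hatf i t = 0.
Proof.
move=> st; apply: hat_out.
by rewrite normrM normfV (gtr0_norm s0) ler_pdivlMr// mul1r.
Qed.

(** The hypothesis on [n] says that the nodes, starting at -M with step [s], reach M. *)
Lemma hatf_sum n t : 2 * M <= n%:R * s -> `|t| <= M ->
  \sum_(i < n.+1) hatf i t = 1.
Proof.
move=> nM; rewrite ler_norml => /andP[t1 t2].
rewrite -[RHS](@hat_sum _ n ((t + M) / s)); last first.
  by rewrite divr_ge0 ?(ltW s0)//= ?ler_pdivrMr//; lra.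
apply: eq_bigr => i _; rewrite /hatf /node; congr hat.
by field; rewrite gt_eqF.
Qed.

Lemma ucontb_pf i : ucontb M (pf i).
Proof.
apply: (@ucontb_lipschitz _ _ (hatf i) s^-1); first by rewrite invr_ge0 ltW.
move=> x y; rewrite (le_trans (hat_lipschitz _ _))// -mulrBl.
have -> : x - node i - (y - node i) = x - y by ring.
by rewrite normrM normfV (gtr0_norm s0) mulrC.
Qed.

Lemma ucontb_qf i : ucontb M (qf i).
Proof. exact/ucontb_sqrt/ucontb_pf. Qed.

Lemma pfE i t : pf i t = qf i t * qf i t.
Proof. by rewrite /pf /qf -realcM -expr2 sqr_sqrtr// hatf_ge0. Qed.

Lemma rnorm_qf i t : rnorm (qf i t) ^+ 2 = hatf i t.
Proof. by rewrite rnorm_real real_normK ?num_real// sqr_sqrtr// hatf_ge0. Qed.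

(** t - node truncated to [[-s, s]]. It agrees with t - node on the support of the hat, and being
    bounded by [s] everywhere it yields the error of norm [s] when A is replaced by a scalar on a
    block. *)
Definition clamp i t : R := Num.max (- s) (Num.min s (t - node i)).

Lemma clamp_le i t : `|clamp i t| <= s.
Proof.
rewrite ler_norml /clamp le_max lexx/= ge_max ge_min lexx andbT.
by have := s0; lra.
Qed.

Lemma clamp_lipschitz i x y : `|clamp i x - clamp i y| <= 1 * `|x - y|.
Proof.
rewrite mul1r; wlog xy : x y / x <= y.
  move=> hw; have [/hw//|/ltW/hw] := leP x y.
  by rewrite distrC [`|y - x|]distrC.
rewrite distrC [`|x - y|]distrC (ger0_norm (x := y - x)) ?subr_ge0//.
rewrite ler_norml /clamp /Num.min /Num.max.
case: (ltP s (y - node i)) => ?; case: (ltP s (x - node i)) => ?;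
  do 2 (try (case: (ltP (- s)) => ?)); by apply/andP; split; lra.
Qed.

Lemma ucontb_clamp i : ucontb M (fun t => (clamp i t)%:C).
Proof. by apply: (@ucontb_lipschitz _ _ (clamp i) 1) => //; exact: clamp_lipschitz. Qed.

Lemma mul_qf i t : t%:C * qf i t = (node i)%:C * qf i t + (clamp i t)%:C * qf i t.
Proof.
have [ts|ts] := leP s `|t - node i|.
  by rewrite /qf hatf_out// sqrtr0 !mulr0 addr0.
rewrite -mulrDl -realcD; congr (_%:C * _).
move: ts; rewrite ltr_norml => /andP[h1 h2].
by rewrite /clamp min_r ?(ltW h2)// max_r ?(ltW h1)// addrC subrK.
Qed.

End Lattice.

(** * The partition of unity applied to one operator *)

Section LatticeOp.
Variables (R : realType) (H : completeNormedModType R[i]).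
Variable dot : {dot H for @Num.conj R[i]}.
Hypothesis dotE : hilbert_norm dot.
Variables (A : {linear H -> H}) (M : R).
Hypotheses (Asa : selfadjoint dot A) (M0 : 0 < M) (AM : opbound A M).
Implicit Types (i n : nat) (s : R) (x y : H).

Definition pop s i := fun_calc (pf M s i) A.
Definition qop s i := fun_calc (qf M s i) A.
Definition clampop s i := fun_calc (fun t => (clamp M s i t)%:C) A.

Lemma pop_qop s i x : 0 < s -> pop s i x = qop s i (qop s i x).
Proof.
move=> s0; rewrite /qop -(fun_calcM dotE Asa M0 AM)//; try exact: ucontb_qf.
by congr (fun_calc _ A x); apply/funext => t; rewrite pfE.
Qed.

Lemma qop_sumsq s n x : 0 < s -> 2 * M <= n%:R * s ->
  \sum_(i < n.+1) rnorm (qop s i x) ^+ 2 <= 1 ^+ 2 * rnorm x ^+ 2.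
Proof.
move=> s0 nM; apply: (fun_calc_sumsq dotE Asa M0 AM (g := fun i : 'I_n.+1 => qf M s i)).
  by move=> i; exact: ucontb_qf.
move=> t tM; under eq_bigr do rewrite rnorm_qf.
by rewrite hatf_sum// expr1n.
Qed.

Lemma qop_opbound s i : 0 < s -> opbound (qop s i) 1.
Proof.
move=> s0; apply: (fun_calc_opbound dotE Asa M0 AM) => //.
  exact: ucontb_qf.
move=> t tM; rewrite -(@ler_pXn2r _ 2) ?nnegrE ?rnorm_ge0// rnorm_qf expr1n.
exact: hat_le1.
Qed.

Lemma dot_qop s i x y : 0 < s -> dot (qop s i x) y = dot x (qop s i y).
Proof.
move=> s0; rewrite (dot_fun_calc dotE Asa M0 AM); last exact: ucontb_qf.
by congr (dot x (fun_calc _ A y)); apply/funext => t; exact: conjc_real.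
Qed.

Lemma pop_sum s n x : 0 < s -> 2 * M <= n%:R * s ->
  \sum_(i < n.+1) pop s i x = x.
Proof.
move=> s0 nM.
have pu i : ucontb M (pf M s i) by exact: ucontb_pf.
rewrite /pop -(fun_calc_sum dotE Asa M0 AM predT (g := fun i : 'I_n.+1 => pf M s i))//.
rewrite -[RHS]scale1r -(fun_calc_cst dotE Asa M0 AM 1).
apply: (fun_calc_eq dotE Asa M0 AM) => [||t tM].
- by apply: ucontb_sum => i.
- exact: ucontb_cst.
- by rewrite -rmorph_sum/= hatf_sum.
Qed.

(** The product of the two hats is zero. The meshes may differ because [near_op_step] compares two
    scales. *)
Lemma pop_disjoint s s' i i' x : 0 < s -> 0 < s' ->
  s + s' <= `|node M s i - node M s' i'| -> pop s i (pop s' i' x) = 0.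
Proof.
move=> s0 s'0 far.
have pu := ucontb_pf M s0 i; have pu' := ucontb_pf M s'0 i'.
rewrite /pop -(fun_calcM dotE Asa M0 AM)//.
apply: (fun_calc_eq0 dotE Asa M0 AM); first exact: ucontbM.
move=> t _; rewrite /pf -realcM.
have [ts|ts] := leP s `|t - node M s i|; first by rewrite hatf_out// mul0r.
rewrite (@hatf_out _ _ s')// ?mulr0//.
have := ler_distD t (node M s i) (node M s' i').
by rewrite [`|node M s i - t|]distrC; lra.
Qed.

Lemma pop_comm s i (g : R -> R[i]) x : 0 < s -> ucontb M g ->
  fun_calc g A (pop s i x) = pop s i (fun_calc g A x).
Proof.
by move=> s0 gu; apply: (fun_calc_comm dotE Asa M0 AM) => //; exact: ucontb_pf.
Qed.

Lemma clampop_opbound s i : 0 < s -> opbound (clampop s i) s.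
Proof.
move=> s0; apply: (fun_calc_opbound dotE Asa M0 AM); first exact: ltW.
  exact: ucontb_clamp.
by move=> t _; rewrite rnorm_real clamp_le.
Qed.

Lemma op_qop s i x : 0 < s ->
  A (qop s i x) = (node M s i)%:C *: qop s i x + clampop s i (qop s i x).
Proof.
move=> s0; have qu := ucontb_qf M s0 i; have cu := ucontb_clamp M s i.
rewrite -[A _](fun_calc_id dotE Asa M0 AM) /qop /clampop.
rewrite -!(fun_calcM dotE Asa M0 AM)//; last exact: ucontb_id.
rewrite -(fun_calcZ dotE Asa M0 AM)// -(fun_calcD dotE Asa M0 AM)//.
- by congr (fun_calc _ A x); apply/funext => t; rewrite mul_qf.
- by apply: ucontbM => //; exact: ucontb_cst.
- exact: ucontbM.
Qed.

Lemma qop_op s i x : 0 < s ->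
  qop s i (A x) = (node M s i)%:C *: qop s i x + qop s i (clampop s i x).
Proof.
move=> s0; have qu := ucontb_qf M s0 i; have cu := ucontb_clamp M s i.
rewrite /qop /clampop (fun_calc_comm dotE Asa M0 AM)// -op_qop//.
by rewrite -!(fun_calc_id dotE Asa M0 AM) (fun_calc_comm dotE Asa M0 AM)//; exact: ucontb_id.
Qed.

Section Holder.
Variables (f : R -> R[i]) (c al : R).
Hypotheses (c0 : 0 < c) (al0 : 0 < al).
Hypothesis fh : forall t u : R, rnorm (f t - f u) <= c * `|t - u| `^ al.

Lemma ucontb_holder : ucontb M f.
Proof.
split.
  exists (c * M `^ al + rnorm (f 0)) => x xM.
  rewrite -[f x](subrK (f 0)) (le_trans (rnormD _ _))// lerD2r.
  rewrite (le_trans (fh _ _))// subr0 ler_pM2l//.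
  by rewrite ge0_ler_powR ?nnegrE ?normr_ge0 ?(ltW al0) ?(ltW M0).
move=> e e0; exists ((e / c) `^ al^-1); first by apply: powR_gt0; rewrite divr_gt0.
move=> x y _ _ xy; rewrite (le_trans (fh _ _))// mulrC -ler_pdivlMr//.
rewrite -[leRHS]powRr1 ?divr_ge0 ?(ltW e0) ?(ltW c0)// -(mulVf (lt0r_neq0 al0)).
by rewrite powRrM ge0_ler_powR ?nnegrE ?normr_ge0 ?(ltW al0) ?powR_ge0.
Qed.

(** The error made on q_i when f is frozen at the node. Its modulus is at most c s^al times q_i,
    which gives [holder_qf_sumsq]. *)
Definition holder_qf s i t : R[i] := (f t - f (node M s i)) * qf M s i t.

Lemma ucontb_holder_qf s i : 0 < s -> ucontb M (holder_qf s i).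
Proof.
move=> s0; apply: ucontbM => //; last exact: ucontb_qf.
by apply: ucontbB => //; [exact: ucontb_holder|exact: ucontb_cst].
Qed.

Lemma holder_qf_sumsq s n t : 0 < s -> 2 * M <= n%:R * s -> `|t| <= M ->
  \sum_(i < n.+1) rnorm (holder_qf s i t) ^+ 2 <= (c * s `^ al) ^+ 2.
Proof.
move=> s0 nM tM; rewrite -[leRHS]mulr1 -(hatf_sum s0 nM tM) mulr_sumr.
apply: ler_sum => i _; rewrite rnormM exprMn rnorm_qf.
have [ts|ts] := leP s `|t - node M s i|; first by rewrite hatf_out// !mulr0.
rewrite ler_wpM2r ?hatf_ge0// ler_pXn2r ?nnegrE ?rnorm_ge0//; last first.
  by rewrite mulr_ge0 ?powR_ge0 ?(ltW c0).
rewrite (le_trans (fh _ _))// ler_pM2l//.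
by rewrite ge0_ler_powR ?nnegrE ?normr_ge0 ?(ltW al0) ?(ltW s0) ?(ltW ts).
Qed.

Lemma fun_calc_holder_qop s i x : 0 < s ->
  fun_calc f A (qop s i x) =
  fun_calc (holder_qf s i) A x + f (node M s i) *: qop s i x.
Proof.
move=> s0; have qu := ucontb_qf M s0 i; have fu := ucontb_holder.
rewrite /qop -(fun_calcM dotE Asa M0 AM)// -(fun_calcZ dotE Asa M0 AM)//.
rewrite -(fun_calcD dotE Asa M0 AM)//.
- congr (fun_calc _ A x); apply/funext => t; rewrite /holder_qf.
  by rewrite -mulrDl subrK.
- exact: ucontb_holder_qf.
- by apply: ucontbM => //; exact: ucontb_cst.
Qed.

Lemma qop_fun_calc_holder s i x : 0 < s ->
  qop s i (fun_calc f A x) =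
  fun_calc (holder_qf s i) A x + f (node M s i) *: qop s i x.
Proof.
move=> s0; rewrite -fun_calc_holder_qop// /qop.
by apply: (fun_calc_comm dotE Asa M0 AM); [exact: ucontb_qf|exact: ucontb_holder].
Qed.

Lemma holder_qop_sumsq s n x : 0 < s -> 2 * M <= n%:R * s ->
  \sum_(i < n.+1) rnorm (fun_calc (holder_qf s i) A x) ^+ 2 <=
  (c * s `^ al) ^+ 2 * rnorm x ^+ 2.
Proof.
move=> s0 nM.
apply: (fun_calc_sumsq dotE Asa M0 AM (g := fun i : 'I_n.+1 => holder_qf s i)).
  by move=> i; exact: ucontb_holder_qf.
by move=> t tM; exact: holder_qf_sumsq.
Qed.

Lemma holder_qop_adj_sumsq s n x : 0 < s -> 2 * M <= n%:R * s ->
  \sum_(i < n.+1) rnorm (fun_calc (fun t => Num.conj (holder_qf s i t)) A x) ^+ 2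
  <= (c * s `^ al) ^+ 2 * rnorm x ^+ 2.
Proof.
move=> s0 nM.
apply: (fun_calc_sumsq dotE Asa M0 AM
  (g := fun (i : 'I_n.+1) t => Num.conj (holder_qf s i t))).
  by move=> i; apply: ucontb_conj; exact: ucontb_holder_qf.
by move=> t tM; under eq_bigr do rewrite rnormJ; exact: holder_qf_sumsq.
Qed.

End Holder.

End LatticeOp.

(** * Decomposition into near and far blocks *)

(** The algebra of one block in [fcomm_band_op]: [Q] is q_i(A), [y] is q_j(B) x, [a] and [b] are the
    values of f at nodes i and j, [u] and [v] come from [holder_qf]. *)
Lemma linear_regroup (K : pzRingType) (V : lmodType K) (Q W : {linear V -> V})
    (a b : K) (u v y : V) :
  u + a *: Q (W y) - Q (W (v + b *: y)) = u + Q ((a - b) *: W y) - Q (W v).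
Proof.
rewrite (linearD W v) (linearZ_LR W) (linearD Q (W v)) !(linearZ_LR Q).
by rewrite scalerBl addrA -[RHS]addrA -opprD [b *: _ + _]addrC.
Qed.

Section TwoOperators.
Variables (R : realType) (H : completeNormedModType R[i]).
Variable dot : {dot H for @Num.conj R[i]}.
Hypothesis dotE : hilbert_norm dot.
Variables (A B X : {linear H -> H}) (M : R).
Hypotheses (Asa : selfadjoint dot A) (Bsa : selfadjoint dot B) (M0 : 0 < M).
Hypotheses (AM : opbound A M) (BM : opbound B M).
Variables (f : R -> R[i]) (c al : R).
Hypotheses (c0 : 0 < c) (al0 : 0 < al) (al1 : al <= 1).
Hypothesis fh : forall t u : R, rnorm (f t - f u) <= c * `|t - u| `^ al.
Implicit Types (s : R) (n D : nat) (x : H) (Z : H -> H).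

Definition fcomm Z x := fun_calc f A (Z x) - Z (fun_calc f B x).

Definition band_op s n (S : rel 'I_n.+1) (W : 'I_n.+1 -> 'I_n.+1 -> H -> H) x :=
  \sum_i \sum_(j | S i j) qop A M s i (W i j (qop B M s j x)).

Section Band.
Variables (s : R) (n D : nat) (S : rel 'I_n.+1) (w : R).
Hypotheses (s0 : 0 < s) (nM : 2 * M <= n%:R * s) (w0 : 0 <= w).
Hypothesis SD : forall i j : 'I_n.+1, S i j -> near_idx D i j.

Let N := D.*2.+1.

Let Srow i : (#|[pred j | S i j]| <= N)%N.
Proof. by apply: (near_idx_card (i := i)) => j; exact: SD. Qed.

Let Scol j : (#|[pred i | S i j]| <= N)%N.
Proof.
by apply: (near_idx_card (i := j)) => i /SD; rewrite near_idx_sym.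
Qed.

Lemma band_op_opbound (W : 'I_n.+1 -> 'I_n.+1 -> H -> H) :
  (forall i j, S i j -> opbound (W i j) w) -> opbound (band_op s S W) (N%:R * w).
Proof.
move=> Ww; rewrite -[N%:R * w]mulr1 -[N%:R * w * 1]mulr1.
apply: (@schur_test _ _ _ dotE _ S N 1 1 w
    (fun i : 'I_n.+1 => qop A M s i) (fun i : 'I_n.+1 => qop A M s i)
    (fun j : 'I_n.+1 => qop B M s j) W) => //.
- by move=> i x y; exact: (dot_qop dotE Asa M0 AM).
- by move=> y; exact: (qop_sumsq dotE Asa M0 AM).
- by move=> y; exact: (qop_sumsq dotE Bsa M0 BM).
Qed.

Lemma fcomm_band_op (W : 'I_n.+1 -> 'I_n.+1 -> {linear H -> H}) : (0 < D)%N ->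
  (forall i j, S i j -> opbound (W i j) w) ->
  opbound (fcomm (band_op s S (fun i j => W i j)))
    (N%:R * D.+2%:R * w * (c * s `^ al)).
Proof.
move=> D0 Ww.
pose k := c * s `^ al; have k0 : 0 < k by rewrite mulr_gt0 ?powR_gt0.
have split_ x : fcomm (band_op s S (fun i j => W i j)) x =
    (\sum_i \sum_(j | S i j)
       fun_calc (holder_qf M f s i) A (W i j (qop B M s j x)) +
     band_op s S (fun i j y => (f (node M s i) - f (node M s j)) *: W i j y) x) -
    \sum_i \sum_(j | S i j)
       qop A M s i (W i j (fun_calc (holder_qf M f s j) B x)).
  rewrite /fcomm /band_op linear_sum/= -big_split/= -!sumrB.
  apply: eq_bigr => i _; rewrite linear_sum/= -big_split/= -!sumrB.
  apply: eq_bigr => j _; rewrite (fun_calc_holder_qop dotE Asa M0 AM c0 al0 fh)//.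
  rewrite (qop_fun_calc_holder dotE Bsa M0 BM c0 al0 fh)//.
  exact: linear_regroup.
move=> x; rewrite split_; move: x.
have -> : N%:R * D.+2%:R * w * k =
    (N%:R * w * k * 1 + N%:R * (D%:R * k * w)) + N%:R * w * 1 * k.
  by rewrite -addn2 natrD; ring.
apply: opboundB; first apply: opboundD.
- apply: (@schur_test _ _ _ dotE _ S N k 1 w
    (fun i : 'I_n.+1 => fun_calc (holder_qf M f s i) A)
    (fun i : 'I_n.+1 => fun_calc (fun t => Num.conj (holder_qf M f s i t)) A)
    (fun j : 'I_n.+1 => qop B M s j) (fun i j => W i j)) => //.
  + move=> i x y; apply: (dot_fun_calc dotE Asa M0 AM).
    exact: (ucontb_holder_qf M0 c0 al0 fh).
  + by move=> y; exact: (holder_qop_adj_sumsq dotE Asa M0 AM c0 al0 fh).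
  + by move=> y; exact: (qop_sumsq dotE Bsa M0 BM).
- move=> x; rewrite -[N%:R * _]mulr1 -[N%:R * _ * 1]mulr1; move: x.
  apply: (@schur_test _ _ _ dotE _ S N 1 1 (D%:R * k * w)
    (fun i : 'I_n.+1 => qop A M s i) (fun i : 'I_n.+1 => qop A M s i)
    (fun j : 'I_n.+1 => qop B M s j)
    (fun i j y => (f (node M s i) - f (node M s j)) *: W i j y)) => //.
  + by rewrite mulr_ge0// mulr_ge0 ?(ltW k0).
  + by move=> i x y; exact: (dot_qop dotE Asa M0 AM).
  + by move=> y; exact: (qop_sumsq dotE Asa M0 AM).
  + by move=> y; exact: (qop_sumsq dotE Bsa M0 BM).
  + move=> i j Sij x; rewrite rnormZ -mulrA.
    apply: ler_pM; rewrite ?rnorm_ge0//; last exact: Ww.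
    rewrite (le_trans (fh _ _))// /k mulrCA ler_pM2l//.
    have -> : node M s i - node M s j = (i%:R - j%:R) * s by rewrite /node; ring.
    rewrite normrM (gtr0_norm s0) powRM// ?(ltW s0)//.
    rewrite ler_wpM2r ?powR_ge0//.
    have := SD Sij; rewrite (near_idxE R) => ij.
    rewrite (@le_trans _ _ (D%:R `^ al))//.
      by rewrite ge0_ler_powR ?nnegrE ?normr_ge0 ?(ltW al0).
    by rewrite -[leRHS]powRr1// ler_powR// ler1n.
- apply: (@schur_test _ _ _ dotE _ S N 1 k w
    (fun i : 'I_n.+1 => qop A M s i) (fun i : 'I_n.+1 => qop A M s i)
    (fun j : 'I_n.+1 => fun_calc (holder_qf M f s j) B) (fun i j => W i j)) => //.
  + exact: ltW.
  + by move=> i x y; exact: (dot_qop dotE Asa M0 AM).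
  + by move=> y; exact: (qop_sumsq dotE Asa M0 AM).
  + by move=> y; exact: (holder_qop_sumsq dotE Bsa M0 BM c0 al0 fh).
Qed.

End Band.

(** One square root of each hat; the other q_i(A) and q_j(B) are supplied by [band_op], so that band
    sums of blocks are sums of p_i(A) X p_j(B). *)
Definition block s i j : {linear H -> H} := qop A M s i \o (X \o qop B M s j).

Variables ka rho : R.
Hypotheses (ka0 : 0 <= ka) (rho0 : 0 <= rho).
Hypothesis (Xrho : opbound X rho).
Hypothesis (Xka : opbound (fun x => A (X x) - X (B x)) ka).

Lemma block_opbound s i j : 0 < s -> opbound (block s i j) rho.
Proof.
move=> s0 x; have Qi := qop_opbound dotE Asa M0 AM i s0.
have Qj := qop_opbound dotE Bsa M0 BM j s0.
rewrite (le_trans (Qi _))// mul1r (le_trans (Xrho _))//.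
by rewrite ler_wpM2l// (le_trans (Qj _))// mul1r.
Qed.

(* [A] acts on the [i]-th block as its node up to an error of norm at most [s],
   and so does [B]; the Sylvester equation then determines a far block. *)
Lemma far_block s i j : 0 < s -> ~~ near_idx 2 i j ->
  opbound (block s i j) (ka / s).
Proof.
move=> s0 far; set W := block s i j; set L := opnorm W.
have Wb : bounded_op W by apply: (opbound_bounded_op rho0); exact: block_opbound.
have L0 : 0 <= L by exact: opnorm_ge0.
have WL : opbound W L by exact: linear_opnormP.
have Qi := qop_opbound dotE Asa M0 AM i s0.
have Qj := qop_opbound dotE Bsa M0 BM j s0.
pose tau := node M s i - node M s j.
have tauE : tau = (i%:R - j%:R) * s by rewrite /tau /node; ring.
have tau3 : 3 * s <= `|tau|.
  by rewrite tauE normrM (gtr0_norm s0) ler_wpM2r ?(ltW s0)//; exact: far_idx.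
have tau0 : 0 < `|tau| by apply: lt_le_trans tau3; rewrite mulr_gt0.
(* The operator q_i(A) (A X - X B) q_j(B) is expanded with A q_i(A) = node q_i(A) + clamp q_i(A),
   and likewise for B. *)
have key x : tau%:C *: W x = qop A M s i
      (A (X (qop B M s j x)) - X (B (qop B M s j x)))
    - clampop A M s i (W x) + W (clampop B M s j x).
  have h1 : qop A M s i (A (X (qop B M s j x))) =
      (node M s i)%:C *: W x + clampop A M s i (W x).
    rewrite -(op_qop dotE Asa M0 AM)// /qop -[in RHS](fun_calc_id dotE Asa M0 AM).
    rewrite -[in LHS](fun_calc_id dotE Asa M0 AM).
    apply: (fun_calc_comm dotE Asa M0 AM); first exact: ucontb_qf.
    exact: ucontb_id.
  have h2 : qop A M s i (X (B (qop B M s j x))) =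
      (node M s j)%:C *: W x + W (clampop B M s j x).
    have -> : B (qop B M s j x) = qop B M s j (B x).
      rewrite -!(fun_calc_id dotE Bsa M0 BM) /qop.
      apply: (fun_calc_comm dotE Bsa M0 BM); last exact: ucontb_qf.
      exact: ucontb_id.
    rewrite (qop_op dotE Bsa M0 BM)// (linearD X) (linearZ_LR X).
    by rewrite (linearD (qop _ _ _ _)) (linearZ_LR (qop _ _ _ _)).
  rewrite linearB h1 h2 realcB scalerBl opprD addrACA -[RHS]addrA -[RHS]addrA.
  by rewrite [X in _ = _ + X]addrACA subrr add0r addNr addr0.
(* Norms are taken in [key]. As |tau| >= 3 s, the term 2 s L is absorbed and s L <= ka remains: this
   fixes 2 as the width of the near band. *)
have tauL : `|tau| * L <= ka + 2 * s * L.
  rewrite -ler_pdivlMl//; apply: opbound_opnorm_le.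
    by rewrite mulr_ge0 ?invr_ge0 ?(ltW tau0)// addr_ge0// !mulr_ge0 ?(ltW s0).
  move=> x; rewrite -[leRHS]mulrA ler_pdivlMl//.
  have -> : `|tau| * rnorm (W x) = rnorm (tau%:C *: W x) by rewrite rnormZ rnorm_real.
  rewrite key (le_trans (rnormD _ _))//.
  have -> : (ka + 2 * s * L) * rnorm x =
     (ka * rnorm x + s * (L * rnorm x)) + L * (s * rnorm x) by ring.
  apply: lerD.
    rewrite (le_trans (rnormB _ _))// lerD//.
      rewrite (le_trans (Qi _))// mul1r (le_trans (Xka _))//.
      by rewrite ler_wpM2l// (le_trans (Qj _))// mul1r.
    rewrite (le_trans (clampop_opbound dotE Asa M0 AM i s0 _))//.
    by rewrite ler_wpM2l ?(ltW s0)// WL.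
  rewrite (le_trans (WL _))// ler_wpM2l//.
  exact: (clampop_opbound dotE Bsa M0 BM j s0).
apply: opbound_le WL; rewrite ler_pdivlMr//.
by have := ler_wpM2r L0 tau3; lra.
Qed.

(** R_s when Z = X; a general [Z] is allowed because the same operation is applied to annulus sums
    and to their commutators. *)
Definition near_op s n Z x :=
  \sum_(i < n.+1) \sum_(j < n.+1 | near_idx 2 i j)
    pop A M s i (Z (pop B M s j x)).

Lemma near_op_opbound s n Z z : 0 < s -> 2 * M <= n%:R * s -> 0 <= z ->
  opbound Z z -> opbound (near_op s n Z) (5 * z).
Proof.
move=> s0 nM z0 Zz x.
pose S : rel 'I_n.+1 := fun i j => near_idx 2 i j.
pose W (i j : 'I_n.+1) y := qop A M s i (Z (qop B M s j y)).
have -> : near_op s n Z x = band_op s S W x.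
  apply: eq_bigr => i _; apply: eq_bigr => j _.
  by rewrite (pop_qop dotE Asa M0 AM)// (pop_qop dotE Bsa M0 BM).
apply: (@band_op_opbound s n 2 S z) => // i j _ y.
have Qi := qop_opbound dotE Asa M0 AM i s0.
have Qj := qop_opbound dotE Bsa M0 BM j s0.
rewrite (le_trans (Qi _))// mul1r (le_trans (Zz _))//.
by rewrite ler_wpM2l// (le_trans (Qj _))// mul1r.
Qed.

(** p_i(A) commutes with f(A), and p_j(B) with f(B). Thus the outer [near_op] in [near_op_step]
    costs only the factor 5 of [near_op_opbound]. *)
Lemma fcomm_near_op s n Z x : 0 < s ->
  fcomm (near_op s n Z) x = near_op s n (fcomm Z) x.
Proof.
move=> s0; have fu := ucontb_holder M0 c0 al0 fh.
rewrite /fcomm /near_op linear_sum/= -sumrB; apply: eq_bigr => i _.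
rewrite linear_sum/= -sumrB; apply: eq_bigr => j _.
rewrite (pop_comm dotE Asa M0 AM)// -(pop_comm dotE Bsa M0 BM)//.
by rewrite -linearB.
Qed.

Lemma pop_sum2 s n x : 0 < s -> 2 * M <= n%:R * s ->
  X x = \sum_(i < n.+1) \sum_(j < n.+1) pop A M s i (X (pop B M s j x)).
Proof.
move=> s0 nM; rewrite -[LHS](pop_sum dotE Asa M0 AM _ s0 nM).
apply: eq_bigr => i _; rewrite -[in LHS](pop_sum dotE Bsa M0 BM x s0 nM).
by rewrite !linear_sum.
Qed.

Lemma near_op_all s n x : 0 < s -> 2 * M <= n%:R * s -> (n <= 2)%N ->
  near_op s n X x = X x.
Proof.
move=> s0 nM n2; rewrite (pop_sum2 x s0 nM); apply: eq_bigr => i _.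
apply: eq_bigl => j; have := ltn_ord i; have := ltn_ord j.
by rewrite /near_idx; lia.
Qed.

Definition annulus n : rel 'I_n.+1 :=
  fun i j => ~~ near_idx 2 i j && near_idx 17 i j.

(* Two hats of meshes [s] and [4 s] overlap only if their nodes are less than
   [5 s] apart.  Hence a pair of indices near at mesh [s] refines only pairs near
   at mesh [4 s], and those are refined only by pairs of width less than
   [(2 * 4 * s + 2 * 5 * s) / s = 18] at mesh [s]. *)
Lemma near_far_separated s (i j i' j' : nat) : 0 < s ->
  `|node M (4 * s) i' - node M s i| < 4 * s + s ->
  `|node M s j - node M (4 * s) j'| < s + 4 * s ->
  ~~ (near_idx 2 i j && ~~ near_idx 2 i' j' ||
      near_idx 2 i' j' && ~~ near_idx 17 i j).
Proof.
move=> s0; set s' := 4 * s => h1 h2; have s'0 : 0 < s' by rewrite mulr_gt0.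
apply/negP => hpq.
have e1 : node M s i - node M s j = (i%:R - j%:R) * s by rewrite /node; ring.
have e2 : node M s' i' - node M s' j' = (i'%:R - j'%:R) * s' by rewrite /node; ring.
have n1 : `|node M s i - node M s j| = `|i%:R - j%:R| * s.
  by rewrite e1 normrM (gtr0_norm s0).
have n2 : `|node M s' i' - node M s' j'| = `|i'%:R - j'%:R| * s'.
  by rewrite e2 normrM (gtr0_norm s'0).
have t1 : `|node M s' i' - node M s' j'| <= `|node M s' i' - node M s i| +
    `|node M s i - node M s j| + `|node M s j - node M s' j'|.
  have := ler_distD (node M s i) (node M s' i') (node M s' j').
  by have := ler_distD (node M s j) (node M s i) (node M s' j'); lra.
have t2 : `|node M s i - node M s j| <= `|node M s' i' - node M s i| +
    `|node M s' i' - node M s' j'| + `|node M s j - node M s' j'|.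
  have := ler_distD (node M s' i') (node M s i) (node M s j).
  have := ler_distD (node M s' j') (node M s' i') (node M s j).
  rewrite [`|node M s' j' - node M s j|]distrC [`|node M s i - node M s' i'|]distrC.
  by lra.
move: t1 t2; rewrite n1 n2 => t1 t2.
case/orP: hpq => /andP[].
  rewrite (near_idxE R) => nij /(far_idx R) fij.
  have := ler_wpM2r (ltW s0) nij; have := ler_wpM2r (ltW s'0) fij.
  by rewrite /s' in t1 t2 h1 h2 *; lra.
rewrite (near_idxE R) => nij /(far_idx R) fij.
have := ler_wpM2r (ltW s'0) nij; have := ler_wpM2r (ltW s0) fij.
by rewrite /s' in t1 t2 h1 h2 *; lra.
Qed.

(** X is expanded in both partitions at once, into terms [T q p] with a coarse pair q and a fine
    pair p. The three operators select subfamilies of these terms, and where the selections disagree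
    [T q p] is zero by [near_far_separated]. *)
Lemma near_op_step s n n' x : 0 < s ->
  2 * M <= n%:R * s -> 2 * M <= n'%:R * (4 * s) ->
  near_op (4 * s) n' X x =
  near_op (4 * s) n' (band_op s (@annulus n) (fun i j => block s i j)) x +
  near_op s n X x.
Proof.
move=> s0 nM n'M; set s' := 4 * s; have s'0 : 0 < s' by rewrite mulr_gt0.
pose T (q : 'I_n'.+1 * 'I_n'.+1) (p : 'I_n.+1 * 'I_n.+1) :=
  pop A M s' q.1 (pop A M s p.1 (X (pop B M s p.2 (pop B M s' q.2 x)))).
have T0 (q : 'I_n'.+1 * 'I_n'.+1) (p : 'I_n.+1 * 'I_n.+1) :
    near_idx 2 p.1 p.2 && ~~ near_idx 2 q.1 q.2 ||
    near_idx 2 q.1 q.2 && ~~ near_idx 17 p.1 p.2 -> T q p = 0.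
  move: p q => [i j] [i' j'] /=; rewrite /T /= => hpq.
  have [h1|h1] := leP (s' + s) `|node M s' i' - node M s i|.
    by rewrite (pop_disjoint dotE Asa M0 AM).
  have [h2|h2] := leP (s + s') `|node M s j - node M s' j'|.
    by rewrite (pop_disjoint dotE Bsa M0 BM)// !linear0.
  by have := near_far_separated s0 h1 h2; rewrite hpq.
have E1 : near_op s' n' X x =
    \sum_(q : 'I_n'.+1 * 'I_n'.+1 | near_idx 2 q.1 q.2) \sum_p T q p.
  rewrite /near_op pair_big_dep/=; apply: eq_bigr => -[i' j'] _ /=.
  rewrite -(pair_bigA _ (fun i j => T (i', j') (i, j)))/=.
  by rewrite (pop_sum2 _ s0 nM) linear_sum; apply: eq_bigr => i _; rewrite linear_sum.
have E2 : near_op s' n' (band_op s (@annulus n) (fun i j => block s i j)) x =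
    \sum_(q : 'I_n'.+1 * 'I_n'.+1 | near_idx 2 q.1 q.2)
      \sum_(p | annulus p.1 p.2) T q p.
  rewrite /near_op pair_big_dep/=; apply: eq_bigr => -[i' j'] _ /=.
  rewrite -(pair_big_dep xpredT (@annulus n) (fun i j => T (i', j') (i, j)))/=.
  rewrite /band_op linear_sum; apply: eq_bigr => i _; rewrite linear_sum.
  apply: eq_bigr => j _; rewrite /T /= /block /=.
  by rewrite (pop_qop dotE Asa M0 AM i)// (pop_qop dotE Bsa M0 BM j).
(* Here the coarse partition of unity is inserted outside the fine one, on both sides of X. *)
have E3 : near_op s n X x =
    \sum_q \sum_(p : 'I_n.+1 * 'I_n.+1 | near_idx 2 p.1 p.2) T q p.
  rewrite exchange_big/= /near_op pair_big_dep/=; apply: eq_bigr => -[i j] _ /=.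
  rewrite -(pair_bigA _ (fun i' j' => T (i', j') (i, j)))/=.
  rewrite -[LHS](pop_sum dotE Asa M0 AM _ s'0 n'M); apply: eq_bigr => i' _.
  rewrite -[in LHS](pop_sum dotE Bsa M0 BM x s'0 n'M) !linear_sum/=.
  by [].
rewrite E1 E2 E3 [in LHS]big_mkcond [X in X + _]big_mkcond -big_split/=.
apply: eq_bigr => q _; case: ifPn => nq; last first.
  by rewrite add0r big1// => p np; apply: T0; rewrite np nq.
rewrite (bigID (fun p : 'I_n.+1 * 'I_n.+1 => near_idx 2 p.1 p.2))/= addrC; congr (_ + _).
rewrite big_mkcond [RHS]big_mkcond; apply: eq_bigr => p _.
rewrite /annulus; case: (boolP (near_idx 2 _ _)) => //= _.
by case: ifPn => // fp; apply: T0; rewrite nq fp orbT.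
Qed.

Lemma fcommD Z1 Z2 x :
  fcomm (fun y => Z1 y + Z2 y) x = fcomm Z1 x + fcomm Z2 x.
Proof. by rewrite /fcomm linearD/= opprD addrACA. Qed.

(** 20 is (2 D + 1)(D + 2) for D = 2. *)
Lemma fcomm_near_op0 s n : 0 < s -> 2 * M <= n%:R * s ->
  opbound (fcomm (near_op s n X)) (20 * rho * (c * s `^ al)).
Proof.
move=> s0 nM x; pose S : rel 'I_n.+1 := fun i j => near_idx 2 i j.
have -> : near_op s n X = band_op s S (fun i j => block s i j).
  apply/funext => y; apply: eq_bigr => i _; apply: eq_bigr => j _.
  by rewrite (pop_qop dotE Asa M0 AM)// (pop_qop dotE Bsa M0 BM).
have := @fcomm_band_op s n 2 S rho s0 nM rho0 (fun i j ij => ij)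
  (fun i j => block s i j) isT (fun i j _ => block_opbound i j s0) x.
by rewrite -natrM.
Qed.

(** 665 is (2 D + 1)(D + 2) for D = 17; the blocks are far, hence ka / s in place of rho. *)
Lemma fcomm_annulus s n : 0 < s -> 2 * M <= n%:R * s ->
  opbound (fcomm (band_op s (@annulus n) (fun i j => block s i j)))
    (665 * (ka / s) * (c * s `^ al)).
Proof.
move=> s0 nM x.
have kas : 0 <= ka / s by rewrite divr_ge0 ?(ltW s0).
have SD (i j : 'I_n.+1) : annulus i j -> near_idx 17 i j by case/andP.
have Sb (i j : 'I_n.+1) : annulus i j -> opbound (block s i j) (ka / s).
  by case/andP=> ij _; exact: far_block.
have := @fcomm_band_op s n 17 (@annulus n) (ka / s) s0 nM kas SD
  (fun i j => block s i j) isT Sb x.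
by rewrite -natrM.
Qed.

Definition mesh_count s := (Num.truncn (2 * M / s)).+1.

Lemma mesh_countP s : 0 < s -> 2 * M <= (mesh_count s)%:R * s.
Proof. by move=> s0; rewrite -ler_pdivrMr// ltW// truncnS_gt. Qed.

(** Each passage from s to 4 s adds 5 times the annulus bound, and 5 times 665 is 3325. Since s^al /
    s = d^(al - 1) 4^((al - 1) k), the increments form a geometric series. *)
Lemma fcomm_near_op_bound (d : R) k : 0 < d ->
  let s := d * 4 ^+ k in
  opbound (fcomm (near_op s (mesh_count s) X))
    (c * (20 * rho * d `^ al +
          3325 * ka * d `^ (al - 1) * \sum_(l < k) (4 `^ (al - 1)) ^+ l)).
Proof.
move=> d0 /=; elim: k => [|k IH].
  rewrite expr0 mulr1 big_ord0 mulr0 addr0 mulrCA.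
  by apply: fcomm_near_op0 => //; exact: mesh_countP.
set s := d * 4 ^+ k in IH; have s0 : 0 < s by rewrite mulr_gt0 ?exprn_gt0.
have -> : d * 4 ^+ k.+1 = 4 * s by rewrite exprS mulrCA.
have s'0 : 0 < 4 * s by rewrite mulr_gt0.
have sM := mesh_countP s0; have s'M := mesh_countP s'0.
have annb := fcomm_annulus s0 sM.
move: (mesh_count s) (mesh_count (4 * s)) => n n' in sM s'M annb IH *.
have -> : near_op (4 * s) n' X = fun y =>
    near_op (4 * s) n' (band_op s (@annulus n) (fun i j => block s i j)) y +
    near_op s n X y.
  by apply/funext => y; exact: near_op_step.
move=> x; rewrite fcommD fcomm_near_op//.
have far := near_op_opbound s'0 s'M _ annb.
have E0 : 0 <= 665 * (ka / s) * (c * s `^ al).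
  apply: mulr_ge0; last by rewrite mulr_ge0 ?powR_ge0 ?(ltW c0).
  by apply: mulr_ge0; [exact: ler0n|rewrite divr_ge0 ?(ltW s0)].
rewrite (le_trans (rnormD _ _))// (le_trans (lerD (far E0 x) (IH x)))//.
rewrite -mulrDl ler_wpM2r ?rnorm_ge0//.
have sal : s `^ al / s = d `^ (al - 1) * (4 `^ (al - 1)) ^+ k.
  rewrite -(mulr_powRB1 (ltW s0) al0) mulrAC mulfV ?gt_eqF// mul1r /s.
  rewrite powRM ?(ltW d0) ?exprn_ge0//; congr (_ * _).
  by rewrite -[4 ^+ k]powR_mulrn// -powRrM mulrC powRrM powR_mulrn ?powR_ge0.
have -> : 5 * (665 * (ka / s) * (c * s `^ al)) = 3325 * ka * c * (s `^ al / s).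
  by ring.
by rewrite sal big_ord_recr/=; nra.
Qed.

Lemma fcomm_bound (d : R) : 0 < d -> al < 1 ->
  opbound (fcomm X)
    (c * (20 * rho * d `^ al +
          3325 * ka * d `^ (al - 1) * (1 - 4 `^ (al - 1))^-1)).
Proof.
move=> d0 al_lt1; set g := 4 `^ (al - 1).
have g1 : g < 1.
  rewrite /g -opprB powRN invf_lt1 ?powR_gt0//.
  have al' : 0 < 1 - al by rewrite subr_gt0.
  have := gt0_ltr_powR al' (x := 1) (y := 4).
  by rewrite powR1; apply; rewrite ?nnegrE ?ler0n// ltr1n.
(* As 4^k > k, this gives d 4^k >= 2 M; at most three nodes then remain, all within distance 2 of
   each other. *)
pose k := Num.truncn (2 * M / d).
have sk : 2 * M <= 1%:R * (d * 4 ^+ k).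
  rewrite mul1r -ler_pdivrMl// [leLHS]mulrC.
  rewrite (le_trans (ltW (truncnS_gt _)))// -natrX ler_nat.
  exact: ltn_expl.
have s0 : 0 < d * 4 ^+ k by rewrite mulr_gt0 ?exprn_gt0.
have n2 : (mesh_count (d * 4 ^+ k) <= 2)%N.
  rewrite /mesh_count ltnS truncn_le_nat ltr_pdivrMr//.
  by move: sk M0; lra.
have := @fcomm_near_op_bound d k d0 => /=.
have -> : near_op (d * 4 ^+ k) (mesh_count (d * 4 ^+ k)) X = X.
  by apply/funext => x; apply: near_op_all => //; exact: mesh_countP.
apply: opbound_le; rewrite ler_pM2l// lerD2l -/g.
have k0 : 0 <= 3325 * ka * d `^ (al - 1).
  by apply: mulr_ge0 (powR_ge0 _ _); apply: mulr_ge0 ka0; exact: ler0n.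
rewrite ler_wpM2l//.
rewrite -[leRHS]mul1r ler_pdivlMr ?subr_gt0//.
have -> : (\sum_(l < k) g ^+ l) * (1 - g) = 1 - g ^+ k.
  by rewrite -opprB mulrN mulrC -subrX1 opprB.
by rewrite gerBl exprn_ge0// powR_ge0.
Qed.

End TwoOperators.

(** * The Hoelder estimate *)

Section HolderNorm.
Variables (R : realType) (alpha : R) (f : R -> R[i]).
Hypothesis fh : holder alpha f.

Lemma holder_norm_ge0 : 0 <= holder_norm alpha f.
Proof.
have q01 : holder_quotients alpha f
    (complex.Re `|f 0 - f 1| / `|0 - 1| `^ alpha).
  by exists 0, 1; rewrite eq_sym oner_eq0.
apply: le_trans (ub_le_sup fh q01).
exact: divr_ge0 (rnorm_ge0 (f 0 - f 1)) (powR_ge0 _ _).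
Qed.

Lemma holder_normP (t u : R) :
  rnorm (f t - f u) <= holder_norm alpha f * `|t - u| `^ alpha.
Proof.
have [->|tu] := eqVneq t u.
  by rewrite subrr rnorm0 mulr_ge0 ?powR_ge0 ?holder_norm_ge0.
rewrite -ler_pdivrMr ?powR_gt0 ?normr_gt0 ?subr_eq0//.
by apply: ub_le_sup => //; exists t, u.
Qed.

End HolderNorm.

(** The two coefficients in [fcomm_bound] add up at d = ka / rho, where rho d^al and ka d^(al - 1)
    both equal ka^al rho^(1 - al). *)
Definition holder_const (R : realType) (alpha : R) : R :=
  20 + 3325 * (1 - 4 `^ (alpha - 1))^-1.

Lemma holder_const_gt0 (R : realType) (alpha : R) :
  alpha < 1 -> 0 < holder_const alpha.
Proof.
move=> al1; apply: ltr_wpDr; last by rewrite ltr0n.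
apply: mulr_ge0; first exact: ler0n.
rewrite invr_ge0 subr_ge0 -opprB powRN invf_le1 ?powR_gt0//.
by rewrite -[leLHS](powRr0 4) ler_powR ?ler1n// subr_ge0 ltW.
Qed.

Section Estimate.
Variables (R : realType) (H : completeNormedModType R[i]).
Variable dot : {dot H for @Num.conj R[i]}.
Hypothesis dotE : hilbert_norm dot.
Variables A B X : {linear H -> H}.
Hypotheses (Ab : bounded_op A) (Asa : selfadjoint dot A).
Hypotheses (Bb : bounded_op B) (Bsa : selfadjoint dot B) (Xb : bounded_op X).
Variables (f : R -> R[i]) (c al : R).
Hypotheses (c0 : 0 < c) (al0 : 0 < al) (al1 : al < 1).
Hypothesis fh : forall t u : R, rnorm (f t - f u) <= c * `|t - u| `^ al.

Let ka := opnorm ((A \o X) \- (X \o B)).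
Let rho := opnorm X.
Let G := (fun_calc f A \o X) \- (X \o fun_calc f B).

Let rho0 : 0 <= rho. Proof. exact: opnorm_ge0. Qed.

Let Kb : bounded_op ((A \o X) \- (X \o B)).
Proof.
apply: (@opbound_bounded_op _ _ _ (opnorm A * rho + rho * opnorm B)).
  by rewrite addr_ge0// mulr_ge0// opnorm_ge0.
apply: opboundB; apply: opbound_comp; rewrite ?opnorm_ge0//;
  exact: linear_opnormP.
Qed.

Let ka0 : 0 <= ka. Proof. exact: opnorm_ge0. Qed.

Let estimate_scale d : 0 < d -> opbound G
  (c * (20 * rho * d `^ al +
        3325 * ka * d `^ (al - 1) * (1 - 4 `^ (al - 1))^-1)).
Proof.
move=> d0; pose M := opnorm A + opnorm B + 1.
have oA := opnorm_ge0 Ab; have oB := opnorm_ge0 Bb.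
have M0 : 0 < M by rewrite /M; lra.
have AM : opbound A M.
  by apply: opbound_le (linear_opnormP Ab); rewrite /M; lra.
have BM : opbound B M.
  by apply: opbound_le (linear_opnormP Bb); rewrite /M; lra.
have Xka : opbound (fun x => A (X x) - X (B x)) ka.
  exact: (linear_opnormP Kb).
exact: (fcomm_bound dotE Asa Bsa M0 AM BM c0 al0 (ltW al1) fh ka0 rho0
  (linear_opnormP Xb) Xka d0 al1).
Qed.

(** The balancing scale ka / rho needs both numbers positive. If rho = 0 then X = 0; if ka = 0 the
    scale can be taken arbitrarily small, so that G = 0. *)
Lemma opnorm_fun_calc_comm :
  opnorm G <= holder_const al * c * ka `^ al * rho `^ (1 - al).
Proof.
have k0 : 0 <= holder_const al by exact/ltW/holder_const_gt0.
have rhs0 : 0 <= holder_const al * c * ka `^ al * rho `^ (1 - al).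
  apply: mulr_ge0 (powR_ge0 _ _); apply: mulr_ge0 (powR_ge0 _ _).
  exact: mulr_ge0 (ltW c0).
have G0 : (forall x, G x = 0) ->
    opnorm G <= holder_const al * c * ka `^ al * rho `^ (1 - al).
  move=> G0; apply: opbound_opnorm_le => // x.
  by rewrite G0 rnorm0 mulr_ge0 ?rnorm_ge0.
have [rhoE|] := eqVneq rho 0.
  have X0 : forall x, X x = 0.
    by apply: opbound0; rewrite -rhoE; exact: linear_opnormP.
  by apply: G0 => x; rewrite /G /= !X0 linear0 subr0.
rewrite neq_lt ltNge rho0/= => rho_gt0.
have [kaE|] := eqVneq ka 0.
  apply: G0; apply: opbound_small => e e0.
  pose k := c * (20 * rho).
  have kp : 0 < k by rewrite !mulr_gt0 ?ltr0n.
  (* Solves 20 c rho d^al = e, the only term left when ka = 0. *)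
  pose d := (e / k) `^ al^-1.
  have d0 : 0 < d by apply: powR_gt0; rewrite divr_gt0.
  have := estimate_scale d0.
  rewrite kaE mulr0 !mul0r addr0 /d -powRrM mulVf ?gt_eqF// powRr1; last first.
    by rewrite divr_ge0 ?ltW.
  by rewrite mulrA -/k mulrC mulfVK ?gt_eqF.
rewrite neq_lt ltNge ka0/= => ka_gt0.
have d0 : 0 < ka / rho by rewrite divr_gt0.
apply: opbound_opnorm_le => //.
have -> : holder_const al * c * ka `^ al * rho `^ (1 - al) =
  c * (20 * rho * (ka / rho) `^ al +
        3325 * ka * (ka / rho) `^ (al - 1) * (1 - 4 `^ (al - 1))^-1).
  have e1 : rho * (ka / rho) `^ al = ka `^ al * rho `^ (1 - al).
    rewrite powRM ?invr_ge0 ?(ltW ka_gt0)// mulrCA; congr (_ * _).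
    rewrite -[rho^-1]powR_inv1 ?(ltW rho_gt0)// -powRrM mulN1r.
    rewrite powRB ?powRr1 ?powRN ?(ltW rho_gt0)//.
    by rewrite (gt_eqF rho_gt0) implybT.
  have e2 : ka * (ka / rho) `^ (al - 1) = ka `^ al * rho `^ (1 - al).
    rewrite powRM ?invr_ge0 ?(ltW ka_gt0)// mulrA mulr_powRB1 ?(ltW ka_gt0)//.
    by rewrite -[rho^-1]powR_inv1 ?(ltW rho_gt0)// -powRrM mulN1r opprB.
  rewrite -(mulrA 20) e1 -(mulrA 3325) e2 /holder_const.
  by move: (_^-1) => v; ring.
exact: estimate_scale.
Qed.

End Estimate.

Theorem theorem10p5 (R : realType) (alpha : R) (halpha : 0 < alpha < 1) :
  exists c : R, 0 < c /\
    forall f : R -> R[i], holder alpha f ->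
    forall (H : completeNormedModType R[i]) (dot : {dot H for @Num.conj R[i]}),
      hilbert_norm dot ->
    forall A B X : {linear H -> H},
      bounded_op A -> selfadjoint dot A ->
      bounded_op B -> selfadjoint dot B ->
      bounded_op X ->
      opnorm ((fun_calc f A \o X) \- (X \o fun_calc f B)) <=
        c * holder_norm alpha f
          * opnorm ((A \o X) \- (X \o B)) `^ alpha * opnorm X `^ (1 - alpha).
Proof.
have /andP[al0 al1] := halpha.
have k0 := holder_const_gt0 al1.
exists (holder_const alpha); split=> // f fh H dot dotE A B X Ab Asa Bb Bsa Xb.
set Y := opnorm _ `^ alpha; set Z := opnorm X `^ _.
(* The estimate requires a positive Hoelder constant, whereas the seminorm of a constant f is 0. It
   is enlarged by an amount that changes the right-hand side by at most [e]. *)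
apply/ler_addgt0Pr => e e0.
have YZ0 : 0 <= holder_const alpha * Y * Z.
  by apply: mulr_ge0 (powR_ge0 _ _); apply: mulr_ge0 (ltW k0) (powR_ge0 _ _).
have q0 : 0 < holder_const alpha * Y * Z + 1 by rewrite ltr_wpDl.
pose c := holder_norm alpha f + e / (holder_const alpha * Y * Z + 1).
have c0 : 0 < c by rewrite /c ltr_wpDl ?holder_norm_ge0// divr_gt0.
have fc t u : rnorm (f t - f u) <= c * `|t - u| `^ alpha.
  rewrite (le_trans (holder_normP fh t u))// ler_wpM2r ?powR_ge0//.
  by rewrite /c lerDl divr_ge0 ?(ltW e0) ?(ltW q0).
apply: le_trans (opnorm_fun_calc_comm dotE Ab Asa Bb Bsa Xb c0 al0 al1 fc) _.
rewrite -/Y -/Z.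
have -> : holder_const alpha * c * Y * Z =
  holder_const alpha * holder_norm alpha f * Y * Z +
  e * ((holder_const alpha * Y * Z) / (holder_const alpha * Y * Z + 1)).
  by rewrite /c; field; rewrite gt_eqF.
rewrite lerD2l ler_piMr ?(ltW e0)// ler_pdivrMr// mul1r lerDl.
exact: ler01.
Qed.
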